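(* For every $K\ge 1$ there exist constants $c_K,C_K>0$ such that the following holds. Let $p,q\ge 2$ be integers with $K^{-1}\le p/q\le K$, let $Q_{p,q}$ be the rectangular commutator grid over the standard presentation $\langle a,b\mid aba^{-1}b^{-1}\rangle$ of $\mathbb Z^2$, and let $v\in V(\partial Q_{p,q})$ be a corner vertex. Then $$c_K\,\lambda_1(Q_{p,q})^{-1/2}\le \mathrm{FL}_v(Q_{p,q})\le C_K\,\lambda_1(Q_{p,q})^{-1/2}.$$ In particular, the exponent $1/2$ already occurs on a two-parameter family of area-minimising diagrams (each $Q_{p,q}$ is an area-minimising van Kampen diagram for its boundary word).
   Context: $Q_{p,q}$ is the rectangular van Kampen diagram over $\langle a,b\mid aba^{-1}b^{-1}\rangle$ tiled by $pq$ square relator faces, with boundary word $a^pb^qa^{-p}b^{-q}$: its vertices are $\{0,\dots,p\}\times\{0,\dots,q\}$, horizontal unit edges are labelled $a$, vertical unit edges $b$, and its faces are the unit squares. A van Kampen diagram is area-minimising if it has the minimum number of faces among diagrams with the same boundary word. For a disk diagram $\Delta$ (finite, connected, simply connected planar $2$-complex) with boundary walk $\partial\Delta$ and interior vertices $V^\circ=V(\Delta)\setminus V(\partial\Delta)\ne\varnothing$, $\lambda_1(\Delta)=\inf_{f\not\equiv0}\dfrac{\sum_{e\in E(\Delta)}(\widetilde f(e^+)-\widetilde f(e^-))^2}{\sum_{v\in V^\circ}\deg(v)f(v)^2}$ over $f:V^\circ\to\mathbb R$, $\widetilde f$ being the extension by $0$ to $V(\partial\Delta)$. Based filling length: for $b\in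 V(\partial\Delta)$, a based shelling is a sequence $\Delta=\Sigma_0\supset\Sigma_1\supset\cdots\supset\Sigma_N=\{b\}$ of finite connected simply connected planar subcomplexes, each step removing a boundary $2$-cell or a boundary spur (a degree-$1$ vertex and its incident edge), with $b\in V(\partial\Sigma_j)$ for all $j$. When a boundary $2$-cell $\sigma$ meeting the current boundary in a connected arc of length $k$ is removed, that arc of the boundary walk is replaced by the complementary arc of $\partial\sigma$ (of length $|\partial\sigma|-k$), and isolated edges or vertices not containing the basepoint are deleted; if the last remaining $2$-cell has its whole boundary on the current boundary, removing it terminates the shelling. $|\partial\Sigma_j|$ is the length of the boundary walk. $\mathrm{FL}_b(\Delta)=\inf\max_{0\le j\le N}|\partial\Sigma_j|$ over based shellings. *)

(* Defs.v *)
From HB Require Import structures.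
From mathcomp Require Import all_boot all_order all_algebra.

Set Implicit Arguments.
Unset Strict Implicit.
Unset Printing Implicit Defensive.

Import Order.TTheory GRing.Theory Num.Theory.

(* Planar 2-complexes are encoded by their darts (oriented edges).  [flip]    *)
(* reverses a dart, [side d] is the region lying to the RIGHT of d: [Some f]  *)
(* for a 2-cell f, [None] for the unbounded region.  [nxt d] is the dart that *)
(* follows d when walking along the border of the region [side d]; bounded    *)
(* cells are thus traversed clockwise and the outer boundary                  *)
(* counterclockwise.                                                          *)
Record cplx := Cplx {
  vert : finType;
  dart : finType;
  cell : finType;
  src  : dart -> vert;
  flip : dart -> dart;
  nxt  : dart -> dart;
  side : dart -> option cell
}.

Arguments src {c} _ : rename.
Arguments flip {c} _ : rename.
Arguments nxt {c} _ : rename.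
Arguments side {c} _ : rename.

Definition tgt (D : cplx) (d : dart D) : vert D := src (flip d).

(* loops count twice *)
Definition deg (D : cplx) (v : vert D) : nat := #|[pred d : dart D | src d == v]|.

Record subcplx (D : cplx) := Sub {
  sverts : {set vert D};
  sdarts : {set dart D};
  scells : {set cell D}
}.

Definition full (D : cplx) : subcplx D := Sub [set: _] [set: _] [set: _].

Definition point (D : cplx) (b : vert D) : subcplx D := Sub [set b] set0 set0.

Record closed_sub (D : cplx) (S : subcplx D) : Prop := ClosedSub {
  csub_flip : forall d, d \in sdarts S -> flip d \in sdarts S;
  csub_src  : forall d, d \in sdarts S -> src d \in sverts S;
  csub_side : forall d f, side d = Some f -> f \in scells S -> d \in sdarts S
}.

Fixpoint walk (D : cplx) (S : subcplx D) (x : vert D) (s : seq (dart D))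
    (y : vert D) : bool :=
  if s is d :: s' then [&& d \in sdarts S, src d == x & walk S (tgt d) s' y]
  else (x \in sverts S) && (x == y).

Definition connected_sub (D : cplx) (S : subcplx D) : Prop :=
  (exists x, x \in sverts S) /\
  (forall x y, x \in sverts S -> y \in sverts S -> exists s, walk S x s y).

(* Edge-path homotopy inside S: insertion and deletion of backtracks and of   *)
(* border walks of 2-cells of S; [orbit nxt d] is the border walk from d.     *)
Inductive homotopic (D : cplx) (S : subcplx D) (x y : vert D) :
    seq (dart D) -> seq (dart D) -> Prop :=
| Htp_refl s : homotopic S x y s s
| Htp_sym s t : homotopic S x y s t -> homotopic S x y t s
| Htp_trans s t u :
    homotopic S x y s t -> homotopic S x y t u -> homotopic S x y s u
| Htp_backtrack s t d :
    walk S x (s ++ t) y -> walk S x (s ++ [:: d; flip d] ++ t) y ->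
    homotopic S x y (s ++ t) (s ++ [:: d; flip d] ++ t)
| Htp_cell s t d f :
    side d = Some f -> f \in scells S ->
    walk S x (s ++ t) y -> walk S x (s ++ orbit nxt d ++ t) y ->
    homotopic S x y (s ++ t) (s ++ orbit nxt d ++ t).

Definition simply_connected_sub (D : cplx) (S : subcplx D) : Prop :=
  forall x s, x \in sverts S -> walk S x s x -> homotopic S x x s [::].

(* [dd_side] and [dd_rot] say that regions are the orbits of [nxt] and that   *)
(* vertices are the orbits of the rotation [nxt \o flip], i.e. that the       *)
(* 1-skeleton is cellularly embedded in a closed oriented surface;            *)
(* [dd_planar] is Euler's formula V + (F + 1) = E + 2 for that surface to be  *)
(* the sphere, the unbounded region counting for one.                         *)
Record disk_diagram (D : cplx) : Prop := DiskDiagram {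
  dd_flipK : involutive (@flip D);
  dd_flipN : forall d : dart D, flip d != d;
  dd_nxt : injective (@nxt D);
  dd_nxt_src : forall d : dart D, src (nxt d) = tgt d;
  dd_rot : forall d d' : dart D,
    src d = src d' -> fconnect (fun e : dart D => nxt (flip e)) d d';
  dd_side : forall d d' : dart D, (side d == side d') = fconnect nxt d d';
  dd_side_onto :
    0 < #|dart D| -> forall o : option (cell D), exists d : dart D, side d = o;
  dd_connected : connected_sub (full D);
  dd_simply_connected : simply_connected_sub (full D);
  dd_planar : #|vert D| + #|cell D|.+1 = #|dart D|./2 + 2
}.

(* The darts of the boundary walk of S (each occurrence of an edge in the     *)
(* walk is one dart with no 2-cell of S on its right); its length; and its    *)
(* vertices, the boundary walk of a single vertex v being the trivial walk    *)
(* at v.                                                                      *)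
Definition bdarts (D : cplx) (S : subcplx D) : {set dart D} :=
  [set d in sdarts S | if side d is Some f then f \notin scells S else true].

Definition blength (D : cplx) (S : subcplx D) : nat := #|bdarts S|.

Definition bverts (D : cplx) (S : subcplx D) : {set vert D} :=
  [set v in sverts S | [exists d in bdarts S, src d == v]
                       || [forall d in sdarts S, src d != v]].

(* A spur: the edge of d together with its degree-one endpoint src d. *)
Definition remove_spur (D : cplx) (S S' : subcplx D) : Prop :=
  exists d : dart D,
    [/\ d \in bdarts S,
        forall e, e \in sdarts S -> src e = src d -> e = d &
        S' = Sub (sverts S :\ src d) (sdarts S :\: [set d; flip d]) (scells S)].

(* The closed cell f meets the boundary of S in a connected arc of length k:  *)
(* the boundary edges of f are the first k edges of its border walk from d,   *)
(* and the vertices of f on the boundary of S are those of this arc.  The     *)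
(* case k = |border of f| is that of a border lying entirely on the boundary. *)
Definition meets_in_arc (D : cplx) (S : subcplx D) (f : cell D) : Prop :=
  exists (d : dart D) (k : nat),
    [/\ side d = Some f, 0 < k <= order nxt d,
        forall i, i < order nxt d ->
          (flip (iter i nxt d) \in bdarts S) = (i < k) &
        forall i, i < order nxt d -> src (iter i nxt d) \in bverts S ->
          exists2 j, j <= k & src (iter i nxt d) = src (iter j nxt d)].

Definition arc_darts (D : cplx) (S : subcplx D) (f : cell D) : {set dart D} :=
  [set d in sdarts S | ((side d == Some f) && (flip d \in bdarts S))
                       || ((side (flip d) == Some f) && (d \in bdarts S))].

(* Darts of A whose edge is a whole component of the graph A, away from b. *)
Definition isolated_darts (D : cplx) (A : {set dart D}) (b : vert D) :
    {set dart D} :=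
  [set d in A | [&& src d != b, tgt d != b &
     [forall e in A, ((src e == src d) || (src e == tgt d)) ==>
                     ((e == d) || (e == flip d))]]].

Definition remove_cell (D : cplx) (b : vert D) (S S' : subcplx D) : Prop :=
  exists f : cell D,
    [/\ f \in scells S, meets_in_arc S f &
        let A := sdarts S :\: arc_darts S f in
        let A' := A :\: isolated_darts A b in
        S' = Sub [set v in sverts S | (v == b) || [exists d in A', src d == v]]
                 A' (scells S :\ f)].

Record based_shelling (D : cplx) (b : vert D) (N : nat) (S : nat -> subcplx D) :
    Prop := BasedShelling {
  bs_start : S 0 = full D;
  bs_end : S N = point b;
  bs_sub : forall j, j <= N -> closed_sub (S j);
  bs_connected : forall j, j <= N -> connected_sub (S j);
  bs_simply_connected : forall j, j <= N -> simply_connected_sub (S j);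
  bs_base : forall j, j <= N -> b \in bverts (S j);
  bs_step : forall j, j < N ->
    remove_cell b (S j) (S j.+1) \/ remove_spur (S j) (S j.+1)
}.

(* Letters x and x^-1 are (x, true) and (x, false). *)
Definition letter (A : eqType) : eqType := (A * bool)%type.

Definition linv (A : eqType) (x : letter A) : letter A := (x.1, ~~ x.2).

Definition winv (A : eqType) (w : seq (letter A)) : seq (letter A) :=
  rev (map (@linv A) w).

(* w is read around the boundary, starting from some boundary vertex. *)
Definition boundary_word (A : eqType) (D : cplx) (lab : dart D -> letter A)
    (w : seq (letter A)) : Prop :=
  (exists2 d : dart D, side d = None & w = map lab (orbit nxt d))
  \/ (#|dart D| = 0 /\ w = [::]).

(* Van Kampen diagrams for w over the presentation < A | rels >: the border   *)
(* of each 2-cell reads a cyclic conjugate of a relator or of its inverse.    *)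
Record van_kampen (A : eqType) (rels : seq (seq (letter A))) (D : cplx)
    (lab : dart D -> letter A) (w : seq (letter A)) : Prop := VanKampen {
  vk_disk : disk_diagram D;
  vk_flip : forall d, lab (flip d) = linv (lab d);
  vk_cell : forall d f, side d = Some f ->
    exists r n, [/\ r \in rels, n <= size r &
      map lab (orbit nxt d) = rot n r \/ map lab (orbit nxt d) = rot n (winv r)];
  vk_boundary : boundary_word lab w
}.

Definition area_minimising (A : eqType) (rels : seq (seq (letter A)))
    (D : cplx) (lab : dart D -> letter A) (w : seq (letter A)) : Prop :=
  van_kampen rels lab w /\
  forall (D' : cplx) (lab' : dart D' -> letter A),
    van_kampen rels lab' w -> #|cell D| <= #|cell D'|.

(* Generators of Z^2: a is [false], b is [true]. *)
Definition la : letter bool := (false, true).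
Definition lA : letter bool := (false, false).
Definition lb : letter bool := (true, true).
Definition lB : letter bool := (true, false).

Definition commutator_rels : seq (seq (letter bool)) := [:: [:: la; lb; lA; lB]].

Definition grid_word (p q : nat) : seq (letter bool) :=
  nseq p la ++ nseq q lb ++ nseq p lA ++ nseq q lB.

(* Darts of the grid are pairs of a vertex and a direction in which a unit    *)
(* edge leaves it; directions are letters: a, b, a^-1, b^-1 are east, north,  *)
(* west, south.                                                               *)
Definition gvert (p q : nat) : finType := ('I_p.+1 * 'I_q.+1)%type.

Definition leaves (p q : nat) (vl : gvert p q * (bool * bool)) : bool :=
  let: ((x, y), l) := vl in
  match l with
  | (false, true) => x < p
  | (true, true) => y < q
  | (false, false) => 0 < x
  | (true, false) => 0 < y
  end.

Definition gdart (p q : nat) : finType :=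
  {vl : gvert p q * (bool * bool) | leaves vl}.

Definition gsrc (p q : nat) (d : gdart p q) : gvert p q := (val d).1.

Definition glab (p q : nat) (d : gdart p q) : letter bool := (val d).2.

Definition gtgt (p q : nat) (d : gdart p q) : gvert p q :=
  let: ((x, y), l) := val d in
  match l with
  | (false, true) => (inord x.+1, y)
  | (true, true) => (x, inord y.+1)
  | (false, false) => (inord x.-1, y)
  | (true, false) => (x, inord y.-1)
  end.

Definition gflip (p q : nat) (d : gdart p q) : gdart p q :=
  insubd d (gtgt d, linv (glab d)).

Definition turn_right (l : letter bool) : letter bool :=
  (~~ l.1, if l.1 then l.2 else ~~ l.2).

(* At the end of d, follow the first edge among: right, straight on, left,    *)
(* back.                                                                      *)
Definition gnxt (p q : nat) (d : gdart p q) : gdart p q :=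
  let l := glab d in
  head d (pmap insub [seq (gtgt d, l') |
            l' <- [:: turn_right l; l; linv (turn_right l); linv l]]).

Definition gcell (p q i j : nat) : option ('I_p * 'I_q) :=
  if (insub i, insub j) is (Some i', Some j') then Some (i', j') else None.

(* (i, j) is the unit square with lower left corner (i, j). *)
Definition gside (p q : nat) (d : gdart p q) : option ('I_p * 'I_q) :=
  let: ((x, y), l) := val d in
  match l with
  | (false, true) => if 0 < y then gcell p q x y.-1 else None
  | (true, true) => gcell p q x y
  | (false, false) => gcell p q x.-1 y
  | (true, false) => if 0 < x then gcell p q x.-1 y.-1 else None
  end.

Definition Q (p q : nat) : cplx :=
  @Cplx (gvert p q) (gdart p q) ('I_p * 'I_q)%type
    (@gsrc p q) (@gflip p q) (@gnxt p q) (@gside p q).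

Definition Qlab (p q : nat) : dart (Q p q) -> letter bool := @glab p q.

Definition corner (p q : nat) (v : vert (Q p q)) : bool :=
  ((v.1 == ord0) || (v.1 == ord_max)) && ((v.2 == ord0) || (v.2 == ord_max)).

From mathcomp Require Import all_classical all_reals all_analysis.

(* The infimum is taken in the extended reals, so that it is +oo when there   *)
(* is no based shelling.                                                      *)
Definition FL (R : realType) (D : cplx) (b : vert D) : \bar R :=
  ereal_inf [set x : \bar R | exists N S, based_shelling b N S /\
    x = ((\max_(j < N.+1) blength (S j))%:R%R)%:E]%classic.

Local Open Scope ring_scope.

Definition inner (D : cplx) : finType := {v : vert D | v \notin bverts (full D)}.

Definition ext0 (R : realType) (D : cplx) (f : inner D -> R) (v : vert D) : R :=
  if insub v is Some u then f u else 0.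

(* The factor 1/2 is there because each edge is a pair of darts. *)
Definition rayleigh (R : realType) (D : cplx) (f : inner D -> R) : R :=
  (2^-1 * \sum_(d : dart D) (ext0 f (tgt d) - ext0 f (src d)) ^+ 2)
  / \sum_(v : inner D) (deg (val v))%:R * f v ^+ 2.

Definition lambda1 (R : realType) (D : cplx) : R :=
  inf [set x : R | exists f : inner D -> R,
    (exists v, f v != 0) /\ x = rayleigh f]%classic.

(* Main.v *)
Require Import Defs.
From mathcomp Require Import all_boot all_order all_algebra.
From mathcomp Require Import zify ring lra.

(** Write Q for the p by q grid.  When p / q stays between 1 / K and K, both FL and the inverse
    square root of lambda1 are comparable to p, so the two inequalities come from four
    one-sided estimates.

    The filling length is at least the length of the boundary walk of Q itself, hence at least
    p.  For the upper bound, the squares are removed one at a time, column after column towards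
    the base corner ([grid_shelling]).  The complexes in between are staircases: every row and
    every column of edges meets their boundary walk at most once in each sense, so that the walk
    has length O(p + q).  Coordinates are counted from the base corner, which treats the four
    corners at once, the orientation of the squares being reversed for two of them.  A staircase
    is a down-set for these coordinates; it is simply connected because each of its vertices is
    joined to the corner by a path that follows one side of the grid and then a row, and because
    these paths are compatible up to homotopy along each edge ([base_path_dart]).

    For lambda1, the one-dimensional Poincare inequality on each row bounds the Rayleigh quotient
    below by a multiple of p^-2 ([rayleigh_ge]), and the product of two tent functions has a
    Rayleigh quotient of at most a multiple of p^-2 + q^-2 ([lambda1_le]).

    Area minimality is Stokes' formula.  In a van Kampen diagram over the commutator, the exponent
    sum of a along a walk depends only on its endpoints, by simple connectivity; it gives an
    abscissa x to each vertex.  The form x dy integrates to 1 or -1 around a cell and to pq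
    along the boundary word, so there are at least pq cells ([area_ge]). *)

Set Implicit Arguments.
Unset Strict Implicit.
Unset Printing Implicit Defensive.

Import Order.TTheory GRing.Theory Num.Theory.

(** * Walks and homotopy *)

Lemma tgt_flip (D : cplx) (d : dart D) :
  involutive (@flip D) -> tgt (flip d) = src d.
Proof. by move=> fK; rewrite /tgt fK. Qed.

Lemma walk_cat (D : cplx) (S : subcplx D) x z s t :
  closed_sub S -> involutive (@flip D) ->
  walk S x (s ++ t) z <-> exists2 y, walk S x s y & walk S y t z.
Proof.
move=> cS fK; have tS d : d \in sdarts S -> tgt d \in sverts S.
  by move=> dS; rewrite /tgt (csub_src cS) ?(csub_flip cS).
elim: s x => [|d s IH] x /=.
  split=> [wt|[y /andP[_ /eqP->]] //]; exists x; rewrite // eqxx andbT.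
  by case: t wt => [/andP[]//|d t /= /and3P[dS /eqP <- _]]; apply: (csub_src cS).
split=> [/and3P[-> -> /IH[y wy wz]]|[y /and3P[-> -> wy] wz]]; first by exists y.
by apply/IH; exists y.
Qed.

Definition rev_walk (D : cplx) (s : seq (dart D)) : seq (dart D) := rev (map flip s).

Section Homotopy.

Variables (D : cplx) (S : subcplx D).
Hypotheses (fK : involutive (@flip D)) (cS : closed_sub S).

Let catP x z s t := @walk_cat D S x z s t cS fK.

Lemma walk1 (d : dart D) : d \in sdarts S -> walk S (src d) [:: d] (tgt d).
Proof. by move=> dS; rewrite /= dS eqxx /tgt (csub_src cS) ?eqxx ?(csub_flip cS). Qed.

Lemma walk_rev x s y : walk S x s y -> walk S y (rev_walk s) x.
Proof.
rewrite /rev_walk; elim: s x => [|d s IH] x /=; first by case/andP=> xS /eqP<-; rewrite xS eqxx.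
case/and3P=> dS /eqP<- w; rewrite rev_cons -cats1; apply/catP; exists (tgt d); first exact: IH.
by have := walk1 (csub_flip cS dS); rewrite tgt_flip.
Qed.

Lemma homotopic_catl z x y a s t :
  walk S z a x -> homotopic S x y s t -> homotopic S z y (a ++ s) (a ++ t).
Proof.
move=> wa; elim=> {s t}.
- by move=> s; apply: Htp_refl.
- by move=> s t _ h; apply: Htp_sym.
- by move=> s t u _ h1 _ h2; apply: Htp_trans h2.
- move=> s t d w1 w2; rewrite !(catA a); apply: Htp_backtrack.
    by rewrite -catA; apply/catP; exists x.
  by rewrite -catA; apply/catP; exists x.
move=> s t d f sd fS w1 w2; rewrite !(catA a); apply: (Htp_cell sd fS).
  by rewrite -catA; apply/catP; exists x.
by rewrite -catA; apply/catP; exists x.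
Qed.

Lemma homotopic_catr x y z a s t :
  walk S y a z -> homotopic S x y s t -> homotopic S x z (s ++ a) (t ++ a).
Proof.
move=> wa; elim=> {s t}.
- by move=> s; apply: Htp_refl.
- by move=> s t _ h; apply: Htp_sym.
- by move=> s t u _ h1 _ h2; apply: Htp_trans h2.
- move=> s t d w1 w2; rewrite -!catA; apply: Htp_backtrack.
    by rewrite catA; apply/catP; exists y.
  by rewrite [_ ++ t ++ a]catA catA; apply/catP; exists y.
move=> s t d f sd fS w1 w2; rewrite -!catA; apply: (Htp_cell sd fS).
  by rewrite catA; apply/catP; exists y.
by rewrite [_ ++ t ++ a]catA catA; apply/catP; exists y.
Qed.

Lemma homotopic_backtrack x y s d t : walk S x s (src d) -> d \in sdarts S ->
  walk S (src d) t y -> homotopic S x y (s ++ t) (s ++ [:: d; flip d] ++ t).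
Proof.
move=> ws dS wt; apply: Htp_backtrack; apply/catP; exists (src d) => //.
by rewrite /= dS eqxx (csub_flip cS) // eqxx tgt_flip.
Qed.

Lemma homotopic_rev_walkl x y s : walk S x s y -> homotopic S y y (rev_walk s ++ s) [::].
Proof.
rewrite /rev_walk; elim: s x => [|d s IH] x; first by move=> _; apply: Htp_refl.
move=> /= /and3P[dS sd ws]; apply: Htp_trans (IH _ ws); apply: Htp_sym.
rewrite rev_cons -cats1 -catA /= -{2}(fK d).
have fdS := csub_flip cS dS.
by apply: homotopic_backtrack => //; apply: walk_rev.
Qed.

(** A family of base paths [P], along each dart of which the concatenation is homotopically
    compatible, plays the role of a contraction: a closed walk [s] at [x] satisfies
    [P x ++ s ~ P x]. *)
Lemma base_paths_simply_connected (b : vert D) (P : vert D -> seq (dart D)) :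
  (forall x, x \in sverts S -> walk S b (P x) x) ->
  (forall d, d \in sdarts S -> homotopic S b (tgt d) (P (src d) ++ [:: d]) (P (tgt d))) ->
  simply_connected_sub S.
Proof.
move=> wP hP x s xS ws.
have ext s' y z : y \in sverts S -> walk S y s' z -> homotopic S b z (P y ++ s') (P z).
  elim: s' y => [|d s' IH] y yS /=.
    by case/andP=> _ /eqP <-; rewrite cats0; apply: Htp_refl.
  case/and3P=> dS /eqP eqy w; rewrite -cat1s catA.
  have tS : tgt d \in sverts S by rewrite /tgt (csub_src cS) ?(csub_flip cS).
  apply: Htp_trans (IH _ tS w); apply: homotopic_catr w _.
  by rewrite -eqy; apply: hP.
have wPx := wP x xS.
have h1 := homotopic_rev_walkl wPx.
apply: Htp_trans (h1); apply: Htp_trans (homotopic_catl (walk_rev wPx) (ext _ _ _ xS ws)).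
rewrite catA; apply: Htp_sym; rewrite -[X in homotopic _ _ _ _ X]cat0s.
exact: homotopic_catr ws h1.
Qed.

Lemma base_paths_connected (b : vert D) (P : vert D -> seq (dart D)) :
  b \in sverts S -> (forall x, x \in sverts S -> walk S b (P x) x) -> connected_sub S.
Proof.
move=> bS wP; split; first by exists b.
move=> x y xS yS; exists (rev_walk (P x) ++ P y); apply/catP; exists b; last exact: wP.
by apply: walk_rev; apply: wP.
Qed.

Lemma base_path_flip (b : vert D) (P : vert D -> seq (dart D)) d :
  d \in sdarts S -> walk S b (P (src d)) (src d) ->
  homotopic S b (tgt d) (P (src d) ++ [:: d]) (P (tgt d)) ->
  homotopic S b (tgt (flip d)) (P (src (flip d)) ++ [:: flip d]) (P (tgt (flip d))).
Proof.
move=> dS wP h; rewrite tgt_flip // -/(tgt d).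
have wf := walk1 (csub_flip cS dS); rewrite tgt_flip // -/(tgt d) in wf.
apply: Htp_trans (Htp_sym (homotopic_catr wf h)) _; apply: Htp_sym.
have := @homotopic_backtrack b (src d) (P (src d)) d [::] wP dS.
rewrite cats0 cats0 -catA /=; apply; rewrite (csub_src cS) //=.
Qed.

(** The border walk of the cell, inserted in front of the second path, ends with the reverse
    of that path. *)
Lemma square_homotopic d f : side d = Some f -> f \in scells S ->
  order nxt d = 4 -> (forall i, iter i nxt d \in sdarts S) ->
  (forall i, src (iter i.+1 nxt d) = tgt (iter i nxt d)) -> src (iter 4 nxt d) = src d ->
  homotopic S (src d) (tgt (nxt d)) [:: d; nxt d]
     [:: flip (nxt (nxt (nxt d))); flip (nxt (nxt d))].
Proof.
move=> sd fS o4 dS s_ s4.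
have := (dS 0, dS 1, dS 2, dS 3, s_ 0, s_ 1, s_ 2, s_ 3) => /=.
set n1 := nxt d; set n2 := nxt n1; set n3 := nxt n2.
case; case; case; case; case; case; case=> dS0 dS1 dS2 dS3 e1 e2 e3 e4.
rewrite /= -/n1 -/n2 -/n3 e4 in s4.
have f3S := csub_flip cS dS3; have f2S := csub_flip cS dS2.
have w2 : walk S (src n3) [:: flip n2] (tgt n1).
  by have := walk1 f2S; rewrite tgt_flip // -/(tgt n2) -e3 e2.
have w3 : walk S (src d) [:: flip n3; flip n2] (tgt n1).
  move: w2 => /= /and3P[-> w2 w2'].
  by rewrite f3S tgt_flip // w2 w2' -/(tgt n3) s4 eqxx.
have orb : orbit nxt d = [:: d; n1; n2; n3] by rewrite /orbit o4.
have w01 : walk S (src d) [:: d; n1] (src n2).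
  by rewrite /= dS0 dS1 e1 e2 !eqxx /= (csub_src cS) ?(csub_flip cS).
have w012 : walk S (src d) [:: d; n1; n2] (src n3).
  by rewrite /= dS0 dS1 dS2 e1 e2 e3 !eqxx /= (csub_src cS) ?(csub_flip cS).
have h3 := homotopic_backtrack w012 dS3 w2.
have h2 := @homotopic_backtrack (src d) (tgt n1) [:: d; n1] n2 [::] w01 dS2.
rewrite -e2 in h2 w3 h3 *; apply: Htp_trans (h2 _) _.
  by rewrite /= eqxx (csub_src cS).
apply: Htp_trans h3 _; apply: Htp_sym.
have := @Htp_cell D S (src d) (src n2) [::] [:: flip n3; flip n2] d f sd fS.
rewrite orb; apply => //.
rewrite cat0s; apply/catP; exists (src d) => //=.
by rewrite dS0 dS1 dS2 dS3 e1 e2 e3 !eqxx s4 (csub_src cS) ?eqxx.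
Qed.

End Homotopy.

(** * The grid in coordinates *)

Section Grid.

Variables p q : nat.

Definition xco (d : gdart p q) : nat := (gsrc d).1.
Definition yco (d : gdart p q) : nat := (gsrc d).2.

Definition leaves_at (x y : nat) (l : letter bool) : bool :=
  match l with
  | (false, true) => x < p
  | (true, true) => y < q
  | (false, false) => 0 < x
  | (true, false) => 0 < y
  end.

(** End points of a unit step; natural subtraction is harmless since steps stay in the grid. *)
Definition xstep (x : nat) (l : letter bool) : nat :=
  if l.1 then x else if l.2 then x.+1 else x.-1.
Definition ystep (y : nat) (l : letter bool) : nat :=
  if l.1 then if l.2 then y.+1 else y.-1 else y.

Lemma gvert_eq (v v' : gvert p q) : v.1 = v'.1 :> nat -> v.2 = v'.2 :> nat -> v = v'.
Proof. by case: v v' => [x y] [x' y'] /= /val_inj-> /val_inj->. Qed.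

Lemma gdart_eq (d d' : gdart p q) :
  xco d = xco d' -> yco d = yco d' -> glab d = glab d' -> d = d'.
Proof.
case: d d' => [[v l] P] [[v' l'] P']; rewrite /xco /yco /glab /gsrc /= => ex ey el.
by apply/val_inj; rewrite /= (gvert_eq ex ey) el.
Qed.

Lemma gdartP (d : gdart p q) : [/\ xco d <= p, yco d <= q & leaves_at (xco d) (yco d) (glab d)].
Proof.
case: d => [[[x y] l] P]; rewrite /xco /yco /glab /gsrc /= -ltnS ltn_ord -ltnS ltn_ord.
by split.
Qed.

Lemma leavesE (v : gvert p q) l : leaves (v, l) = leaves_at v.1 v.2 l.
Proof. by case: v. Qed.

Lemma gtgtE (d : gdart p q) :
  (gtgt d).1 = xstep (xco d) (glab d) :> nat /\ (gtgt d).2 = ystep (yco d) (glab d) :> nat.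
Proof.
have [] := gdartP d.
case: d => [[[x y] [[] []]] P]; rewrite /xco /yco /glab /gsrc /gtgt /xstep /ystep /leaves_at /=;
  by move=> hx hy hl; rewrite ?inordK //; lia.
Qed.

Lemma gdart_ex (v : gvert p q) l : leaves_at v.1 v.2 l ->
  exists d : gdart p q, gsrc d = v /\ glab d = l.
Proof. by rewrite -leavesE => P; exists (exist _ (v, l) P). Qed.

Lemma gflip_val (d : gdart p q) : val (gflip d) = (gtgt d, linv (glab d)).
Proof.
rewrite /gflip val_insubd leavesE; have [-> ->] := gtgtE d.
suff -> : leaves_at (xstep (xco d) (glab d)) (ystep (yco d) (glab d)) (linv (glab d)) by [].
by have [] := gdartP d; case: (glab d) => [[] []]; rewrite /leaves_at /xstep /ystep /=; lia.
Qed.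

Lemma gflipE (d : gdart p q) : [/\ xco (gflip d) = xstep (xco d) (glab d),
  yco (gflip d) = ystep (yco d) (glab d) & glab (gflip d) = linv (glab d)].
Proof.
by rewrite /xco /yco {3}/glab /gsrc gflip_val /=; have [-> ->] := gtgtE d.
Qed.

(** The rule of [gnxt], for an arbitrary set [L] of directions available at the end point. *)
Definition turn (L : pred (letter bool)) (l : letter bool) : letter bool :=
  if L (turn_right l) then turn_right l
  else if L l then l
  else if L (linv (turn_right l)) then linv (turn_right l) else linv l.

Local Arguments leaves : simpl never.
Local Arguments turn_right : simpl never.
Local Arguments linv : simpl never.

Lemma gnxtE (d : gdart p q) : [/\ xco (gnxt d) = xstep (xco d) (glab d),
  yco (gnxt d) = ystep (yco d) (glab d) &
  glab (gnxt d) = turn (leaves_at (xstep (xco d) (glab d)) (ystep (yco d) (glab d))) (glab d)].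
Proof.
have [tx ty] := gtgtE d.
suff e : val (gnxt d) =
    (gtgt d, turn (leaves_at (xstep (xco d) (glab d)) (ystep (yco d) (glab d))) (glab d)).
  by rewrite /xco /yco {3}/glab /gsrc e /= tx ty.
have vi (vl : gvert p q * letter bool) : leaves vl -> exists2 u : gdart p q,
    insub vl = Some u & val u = vl.
  by move=> P; exists (exist _ vl P); rewrite // insubT.
have back : leaves (gtgt d, linv (glab d)) by rewrite -gflip_val; apply: valP.
rewrite /gnxt /turn -tx -ty -!leavesE /=.
case: ifP => [h|/negbT n1]; first by have [u -> /=] := vi _ h.
rewrite /= [insub (_, turn_right _)]insubN //=; case: ifP => [h|/negbT n2];
  first by have [u -> /=] := vi _ h.
rewrite /= [insub (_, glab _)]insubN //=; case: ifP => [h|/negbT n3];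
  first by have [u -> /=] := vi _ h.
by rewrite /= [insub (_, linv (turn_right _))]insubN //=; have [u -> /=] := vi _ back.
Qed.

Lemma gcellE i j c : (gcell p q i j == Some c) = (i == c.1) && (j == c.2).
Proof.
case: c => c1 c2; rewrite /gcell /=; case: insubP => [i' _ <-|ni]; last first.
  by apply/esym/negbTE/negP => /andP[/eqP e _]; move: ni; rewrite e ltn_ord.
case: insubP => [j' _ <-|nj]; last first.
  by apply/esym/negbTE/negP => /andP[_ /eqP e]; move: nj; rewrite e ltn_ord.
by apply/eqP/andP => [[-> ->] //|[/eqP/val_inj-> /eqP/val_inj->]].
Qed.

(** Which square lies on the right of an edge, as equations between coordinates; the two
    predicates [on_cell] and [on_outer] leave only linear arithmetic to the lemmas on [gside]. *)
Definition on_cell (x y : nat) (l : letter bool) (i j : nat) : bool :=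
  match l with
  | (false, true) => (i == x) && (j.+1 == y)
  | (true, true) => (i == x) && (j == y)
  | (false, false) => (i.+1 == x) && (j == y)
  | (true, false) => (i.+1 == x) && (j.+1 == y)
  end.

Lemma gsideE (d : gdart p q) (c : 'I_p * 'I_q) :
  (gside d == Some c) = on_cell (xco d) (yco d) (glab d) c.1 c.2.
Proof.
have := gdartP d; case: d => [[[[x ?] [y ?]] l] P].
rewrite /gside /xco /yco /glab /gsrc /=; case: c => [[i ?] [j ?]].
case: {P} l => [[] []] /= [hx hy hl]; rewrite ?hl ?gcellE /=.
all: try (case: ifP => y0; rewrite ?gcellE /=).
all: apply/idP/idP => //; case/andP=> /eqP e1 /eqP e2; try (apply/andP; split; apply/eqP); lia.
Qed.

Definition on_outer (x y : nat) (l : letter bool) : bool :=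
  match l with
  | (false, true) => y == 0
  | (true, true) => x == p
  | (false, false) => y == q
  | (true, false) => x == 0
  end.

Lemma gside_NoneE (d : gdart p q) : (gside d == None) = on_outer (xco d) (yco d) (glab d).
Proof.
have gN i j : (gcell p q i j == None) = ~~ ((i < p) && (j < q)).
  by rewrite /gcell; do 2?case: insubP => /= [? -> _|/negbTE -> //].
have := gdartP d; case: d => [[[[x ?] [y ?]] l] P].
rewrite /gside /xco /yco /glab /gsrc /=.
case: {P} l => [[] []] /= [hx hy hl]; rewrite ?hl ?gN.
all: try (case: ifP => y0; rewrite ?gN ?eqxx /=); lia.
Qed.

(** The next side of the square on the right of [d] is the edge to turn into. *)
Lemma gnxt_cell (d : gdart p q) c : gside d = Some c ->
  glab (gnxt d) = turn_right (glab d).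
Proof.
move/eqP; rewrite gsideE; have [_ _ ->] := gnxtE d; have [] := gdartP d.
have := (ltn_ord c.1, ltn_ord c.2); rewrite /turn /turn_right /xstep /ystep /leaves_at /on_cell.
by case: (glab d) => [[] []] /= [h1 h2] hx hy hl hc; (rewrite ifT //; lia).
Qed.

Lemma gside_nxt (d : gdart p q) : gside (gnxt d) = gside d.
Proof.
case e : (gside d) => [c|]; apply/eqP.
  have := gnxt_cell e; move/eqP: e; rewrite !gsideE; have [-> -> _] := gnxtE d => hc ->.
  have [hx hy hl] := gdartP d; move: hx hy hl hc;
    rewrite /turn_right /xstep /ystep /leaves_at /on_cell.
  by case: (glab d) => [[] []] /=; lia.
move/eqP: e; rewrite !gside_NoneE; have [-> -> ->] := gnxtE d.
have [hx hy hl] := gdartP d; move: hx hy hl;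
  rewrite /turn /turn_right /linv /xstep /ystep /leaves_at /on_outer.
by case: (glab d) => [[] []] /=; repeat case: ifP; lia.
Qed.

Lemma gnxt_orbit_cell (d : gdart p q) c : gside d = Some c ->
  orbit (@gnxt p q) d = [:: d; gnxt d; gnxt (gnxt d); gnxt (gnxt (gnxt d))] /\
  gnxt (gnxt (gnxt (gnxt d))) = d.
Proof.
move=> s0; have s1 := s0; rewrite -gside_nxt in s1; have s2 := s1; rewrite -gside_nxt in s2.
have s3 := s2; rewrite -gside_nxt in s3.
have l1 := gnxt_cell s0; have l2 := gnxt_cell s1; have l3 := gnxt_cell s2;
  have l4 := gnxt_cell s3.
have [x1 y1 _] := gnxtE d; have [x2 y2 _] := gnxtE (gnxt d).
have [x3 y3 _] := gnxtE (gnxt (gnxt d)); have [x4 y4 _] := gnxtE (gnxt (gnxt (gnxt d))).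
set d1 := gnxt d in x1 y1 x2 y2 x3 y3 x4 y4 l1 l2 l3 l4 *.
set d2 := gnxt d1 in x2 y2 x3 y3 x4 y4 l2 l3 l4 *.
set d3 := gnxt d2 in x3 y3 x4 y4 l3 l4 *.
have cyc : gnxt d3 = d.
  have [hx hy hl] := gdartP d; move/eqP: s0; rewrite gsideE => hc.
  apply: gdart_eq; rewrite ?x4 ?y4 ?l4 ?x3 ?y3 ?l3 ?x2 ?y2 ?l2 ?x1 ?y1 ?l1; move: hx hy hl hc;
    rewrite /turn_right /xstep /ystep /leaves_at /on_cell; by case: (glab d) => [[] []] //=; lia.
have u : uniq [:: d; d1; d2; d3].
  apply: (@map_uniq _ _ (@glab p q)); rewrite /= l3 l2 l1 /turn_right.
  by case: (glab d) => [[] []].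
split=> //; rewrite (orbitE _ u) ?mem_head //=; first by rewrite eqxx rot0.
by rewrite /frel /= cyc !eqxx.
Qed.

Lemma gflipK : involutive (@gflip p q).
Proof.
move=> d; have [x1 y1 l1] := gflipE d; have [x2 y2 l2] := gflipE (gflip d).
have [hx hy hl] := gdartP d.
apply: gdart_eq; rewrite ?x2 ?y2 ?l2 ?x1 ?y1 ?l1; move: hx hy hl;
  by rewrite /xstep /ystep /leaves_at /linv; case: (glab d) => [[] []] //=; lia.
Qed.

Lemma gflipN (d : gdart p q) : gflip d != d.
Proof.
apply/eqP => e; have [_ _] := gflipE d; rewrite e /linv; by case: (glab d) => [[] []].
Qed.

Lemma gnxt_src (d : gdart p q) : gsrc (gnxt d) = gsrc (gflip d).
Proof.
have [x1 y1 _] := gflipE d; have [x2 y2 _] := gnxtE d.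
by apply: gvert_eq; rewrite -/(xco _) -/(yco _) ?x1 ?x2 ?y1 ?y2.
Qed.

Lemma turn_inj (L : pred (letter bool)) l l' : L (linv l) -> L (linv l') ->
  turn L l = turn L l' -> l = l'.
Proof.
rewrite /turn /turn_right /linv.
case: l l' => [[] []] [[] []] //=; by do ![case: ifP => // _] => //; do ![case: ifP => //].
Qed.

Lemma eq_turn (L L' : pred (letter bool)) : L =1 L' -> turn L =1 turn L'.
Proof. by move=> e l; rewrite /turn !e. Qed.

(** Reversing an edge and then applying the rule gives the next edge in counterclockwise order;
    as there are four directions, at most three steps reach any other edge. *)
Lemma turn_transitive (L : pred (letter bool)) l l' : L l -> L l' ->
  exists n, l' = iter n (fun k => turn L (linv k)) l.
Proof.
pose L' a b c d : pred (letter bool) := fun k =>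
  if k.1 then if k.2 then a else b else if k.2 then c else d.
have eL : L =1 L' (L (true, true)) (L (true, false)) (L (false, true)) (L (false, false)).
  by case=> [[] []].
move=> Ll Ll'; rewrite eL in Ll; rewrite eL in Ll'.
suff [n en] : exists n, l' = iter n (fun k => turn (L' (L (true, true)) (L (true, false))
    (L (false, true)) (L (false, false))) (linv k)) l.
  by exists n; rewrite en; apply: eq_iter => k; rewrite (eq_turn eL).
move: Ll Ll'; move: (L _) (L _) (L _) (L _) => d c b a {eL}.
pose r k := turn (L' a b c d) (linv k) => Ll Ll'.
suff : [|| l' == l, l' == r l, l' == r (r l) | l' == r (r (r l))].
  by case/or4P=> /eqP ->; [exists 0|exists 1|exists 2|exists 3].
move: Ll Ll'; rewrite /r {r}.
by case: l => [[] []]; case: l' => [[] []]; case: (a) (b) (c) (d) => [] [] [] [].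
Qed.

Lemma gnxt_inj : injective (@gnxt p q).
Proof.
move=> d d' e; have [x1 y1 l1] := gnxtE d; have [x2 y2 l2] := gnxtE d'.
have [hx hy hl] := gdartP d; have [hx' hy' hl'] := gdartP d'.
rewrite e x2 in x1; rewrite e y2 in y1; rewrite e l2 x1 y1 in l1.
have el : glab d' = glab d.
  apply: turn_inj l1; last first.
    by move: hx hy hl; rewrite /leaves_at /xstep /ystep /linv; case: (glab d) => [[] []] //=; lia.
  rewrite -x1 -y1.
  by move: hx' hy' hl'; rewrite /leaves_at /xstep /ystep /linv; case: (glab d') => [[] []] //=;
    lia.
move: hx hy hl hx' hy' hl' x1 y1; rewrite el => hx hy hl hx' hy' hl' x1 y1.
apply: gdart_eq => //; move: hx hy hl hx' hy' hl' x1 y1; rewrite /leaves_at /xstep /ystep;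
  by case: (glab d) => [[] []] //=; lia.
Qed.

Lemma grot (d d' : gdart p q) : gsrc d = gsrc d' ->
  fconnect (fun e : gdart p q => gnxt (gflip e)) d d'.
Proof.
move=> es; have [hx hy hl] := gdartP d; have [hx' hy' hl'] := gdartP d'.
have ex : xco d' = xco d by rewrite /xco es.
have ey : yco d' = yco d by rewrite /yco es.
rewrite ex ey in hl'; have [n en] := turn_transitive hl hl'.
suff -> : d' = iter n (fun e : gdart p q => gnxt (gflip e)) d by apply: fconnect_iter.
have [h1 h2 h3] : [/\ xco (iter n (fun e : gdart p q => gnxt (gflip e)) d) = xco d,
    yco (iter n (fun e : gdart p q => gnxt (gflip e)) d) = yco d &
    glab (iter n (fun e : gdart p q => gnxt (gflip e)) d) =
    iter n (fun k => turn (leaves_at (xco d) (yco d)) (linv k)) (glab d)].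
  elim: n {en} => [//|n [IHx IHy IHl]] /=; set e := iter n _ d in IHx IHy IHl *.
  have [x1 y1 l1] := gflipE e; have [-> -> ->] := gnxtE (gflip e).
  have [kx ky kl] := gdartP e.
  have ex' : xstep (xco (gflip e)) (glab (gflip e)) = xco d.
    rewrite x1 l1 -IHx; move: kx kl; rewrite /xstep /leaves_at /linv.
    by case: (glab e) => [[] []] //=; lia.
  have ey' : ystep (yco (gflip e)) (glab (gflip e)) = yco d.
    rewrite y1 l1 -IHy; move: ky kl; rewrite /ystep /leaves_at /linv.
    by case: (glab e) => [[] []] //=; lia.
  by rewrite ex' ey' l1 IHl.
by apply: gdart_eq; rewrite ?h1 ?h2 ?h3.
Qed.

Hypotheses (p0 : 0 < p) (q0 : 0 < q).

Lemma leaves_origin : @leaves p q ((ord0, ord0), (false, true)). Proof. exact: p0. Qed.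

(** Total for convenience; meaningful only under the hypotheses of [dart_atE]. *)
Definition dart_at (x y : nat) (l : letter bool) : gdart p q :=
  insubd (exist (fun vl => leaves vl) _ leaves_origin) ((inord x, inord y), l).

Lemma dart_atE x y l : x <= p -> y <= q -> leaves_at x y l ->
  [/\ xco (dart_at x y l) = x, yco (dart_at x y l) = y & glab (dart_at x y l) = l].
Proof.
move=> hx hy hl; have e : val (dart_at x y l) = ((inord x, inord y), l).
  by rewrite val_insubd leavesE /= !inordK ?hl.
by rewrite /xco /yco /glab /gsrc e /= !inordK.
Qed.

Local Ltac cases := repeat first [case: eqP => /= ? | case: ltnP => /= ?].

(** The outer boundary, counterclockwise from the origin. *)
Definition outer (k : nat) : gdart p q :=
  if k < p then dart_at k 0 la
  else if k < p + q then dart_at p (k - p) lb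
  else if k < p + q + p then dart_at (p + q + p - k) q lA
  else dart_at 0 (p + q + p + q - k) lB.

Lemma outerE k : k < p + q + p + q ->
  [/\ xco (outer k) = if k < p then k else if k < p + q then p
                      else if k < p + q + p then p + q + p - k else 0,
      yco (outer k) = if k < p then 0 else if k < p + q then k - p
                      else if k < p + q + p then q else p + q + p + q - k &
      glab (outer k) = if k < p then la else if k < p + q then lb
                      else if k < p + q + p then lA else lB].
Proof.
move=> hk; rewrite /outer; do ![case: ifP => ?]; apply: dart_atE; rewrite /leaves_at /=; lia.
Qed.

Lemma gnxt_outer k : k < p + q + p + q ->
  gnxt (outer k) = outer (if k.+1 == p + q + p + q then 0 else k.+1).
Proof.
move=> hk; have [x1 y1 l1] := outerE hk.
have hk' : (if k.+1 == p + q + p + q then 0 else k.+1) < p + q + p + q by case: eqP; lia.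
have [x2 y2 l2] := outerE hk'; have [x3 y3 l3] := gnxtE (outer k).
apply: gdart_eq; rewrite ?x3 ?y3 ?l3 ?x2 ?y2 ?l2 ?x1 ?y1 ?l1.
all: clear - hk p0 q0; rewrite /la /lb /lA /lB.
- by rewrite /xstep; cases; lia.
- by rewrite /ystep; cases; lia.
by rewrite /turn /turn_right /linv /leaves_at /xstep /ystep; cases; rewrite //; lia.
Qed.

Let N := p + q + p + q.

Lemma outer_iter k : k < N -> outer k = iter k (@gnxt p q) (outer 0).
Proof.
elim: k => [//|k IH] hk; rewrite iterS -IH ?gnxt_outer; try (rewrite /N in hk; lia).
by rewrite ifN //; apply/eqP; rewrite /N in hk; lia.
Qed.

Lemma outer_walk_cycle : fcycle (@gnxt p q) (traject (@gnxt p q) (outer 0) N).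
Proof.
have N0 : 0 < N by rewrite /N; lia.
have hN : gnxt (outer N.-1) = outer 0.
  by rewrite gnxt_outer ?ifT //; [apply/eqP|]; rewrite -/N; lia.
case: N N0 hN outer_iter => // n _ /= hN it.
by rewrite rcons_path fpath_traject last_traject /= -it ?hN.
Qed.

Lemma outer_walk_mkseq : traject (@gnxt p q) (outer 0) N = mkseq outer N.
Proof.
apply: (@eq_from_nth _ (outer 0)); rewrite size_traject ?size_mkseq // => i hi.
by rewrite nth_traject // nth_mkseq // -outer_iter.
Qed.

Lemma outer_walk_uniq : uniq (mkseq outer N).
Proof.
apply/mkseq_uniqP => i j; rewrite !inE => hi hj e.
have [x1 y1 l1] := outerE hi; have [x2 y2 l2] := outerE hj.
rewrite e x2 in x1; rewrite e y2 in y1; rewrite e l2 in l1.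
move: hi hj x1 y1 l1; rewrite /N; do ![case: ifP => //= ?]; lia.
Qed.

Lemma outer_orbit : orbit (@gnxt p q) (outer 0) = mkseq outer N.
Proof.
have N0 : 0 < N by rewrite /N; lia.
have := outer_walk_cycle; have := outer_walk_uniq; rewrite -outer_walk_mkseq.
case: N N0 => // n _ u c; rewrite (orbitE c u) /= ?mem_head //.
by rewrite eqxx rot0.
Qed.

Lemma outer_onto (d : gdart p q) : gside d = None -> exists2 k, k < N & d = outer k.
Proof.
move/eqP; rewrite gside_NoneE => ho; have [hx hy hl] := gdartP d.
have : exists2 k, k < N & [/\ xco d = if k < p then k else if k < p + q then p
                      else if k < p + q + p then p + q + p - k else 0,
      yco d = if k < p then 0 else if k < p + q then k - p
                      else if k < p + q + p then q else p + q + p + q - k &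
      glab d = if k < p then la else if k < p + q then lb
                      else if k < p + q + p then lA else lB].
  move: hx hy hl ho; rewrite /leaves_at /on_outer /N; case: (glab d) => [[] []] hx hy hl ho.
  - by exists (p + yco d); [lia|split; do ![case: ifP => //= ?]; lia].
  - by exists (p + q + p + (q - yco d)); [lia|split; do ![case: ifP => //= ?]; lia].
  - by exists (xco d); [lia|split; do ![case: ifP => //= ?]; lia].
  by exists (p + q + (p - xco d)); [lia|split; do ![case: ifP => //= ?]; lia].
case=> k hk [h1 h2 h3]; exists k => //; have [g1 g2 g3] := outerE hk.
by apply: gdart_eq; rewrite ?h1 ?h2 ?h3 ?g1 ?g2 ?g3.
Qed.

Lemma gside_outer k : k < N -> gside (outer k) = None.
Proof.
move=> hk; apply/eqP; rewrite gside_NoneE; have [-> -> ->] := outerE hk.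
move: hk; rewrite /N /on_outer; do ![case: ifP => //= ?]; lia.
Qed.

(** The orbits of [gnxt] are the regions: around a square the label determines the edge and takes
    its four values, and every edge with no square on its right is some [outer k], in the orbit of
    [outer 0]. *)
Lemma gside_fconnect (d d' : gdart p q) : (gside d == gside d') = fconnect (@gnxt p q) d d'.
Proof.
apply/eqP/idP; last first.
  by apply: (@fconnect_invariant _ _ _ (@gside p q)) => e; rewrite /= gside_nxt eqxx.
case e: (gside d) => [c|] e'.
  have l1 := gnxt_cell e.
  have s1 := e; rewrite -gside_nxt in s1; have s2 := s1; rewrite -gside_nxt in s2.
  have s3 := s2; rewrite -gside_nxt in s3.
  have l2 := gnxt_cell s1; have l3 := gnxt_cell s2.
  have same d1 d2 : gside d1 = Some c -> gside d2 = Some c -> glab d1 = glab d2 -> d1 = d2.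
    move=> /eqP; rewrite gsideE => h1 /eqP; rewrite gsideE => h2 el.
    apply: gdart_eq => //; move: h1 h2; rewrite el /on_cell; case: (glab d2) => [[] []]; lia.
  have : [|| glab d' == glab d, glab d' == glab (gnxt d), glab d' == glab (gnxt (gnxt d)) |
      glab d' == glab (gnxt (gnxt (gnxt d)))].
    by rewrite l3 l2 l1 /turn_right; case: (glab d) => [[] []]; case: (glab d') => [[] []].
  case/or4P=> /eqP el.
  - by rewrite (same d' _ (esym e') e el) connect0.
  - by rewrite (same d' _ (esym e') s1 el) fconnect1.
  - by rewrite (same d' _ (esym e') s2 el) (fconnect_iter _ 2).
  by rewrite (same d' _ (esym e') s3 el) (fconnect_iter _ 3).
have [k hk ->] := outer_onto e; have [k' hk' ->] := outer_onto (esym e').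
apply: (@connect_trans _ _ (outer 0)).
  by rewrite fconnect_sym; [rewrite (outer_iter hk) fconnect_iter|exact: gnxt_inj].
by rewrite (outer_iter hk') fconnect_iter.
Qed.

Lemma outer_word : map (@glab p q) (mkseq outer N) = grid_word p q.
Proof.
have seg m n l : m + n <= N -> (forall i, m <= i < m + n -> glab (outer i) = l) ->
    map (@glab p q \o outer) (iota m n) = nseq n l.
  move=> mn h; rewrite -{2}(size_iota m n) -(size_map (@glab p q \o outer)).
  apply/all_pred1P/allP => _ /mapP[i + ->]; rewrite mem_iota => hi /=.
  by rewrite h.
rewrite /mkseq -map_comp /N -!addnA !iotaD !map_cat /grid_word.
congr (_ ++ (_ ++ (_ ++ _))); apply: seg => [|i hi]; rewrite /N; try lia.
all: have [|_ _ ->] := @outerE i; first by rewrite /N; lia.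
all: do ![case: ifP => //= ?]; lia.
Qed.

Lemma gside_onto (o : option ('I_p * 'I_q)) : exists d : gdart p q, gside d = o.
Proof.
case: o => [[i j]|]; last by exists (outer 0); apply: gside_outer; rewrite /N; lia.
have hi := ltn_ord i; have hj := ltn_ord j.
have [|||x y l] := @dart_atE i j (true, true); rewrite /leaves_at; try lia.
by exists (dart_at i j (true, true)); apply/eqP; rewrite gsideE x y l /on_cell /= !eqxx.
Qed.

Lemma card_gdart : #|{: gdart p q}| = 2 * (p * q.+1 + p.+1 * q).
Proof.
have sumI n k : k <= n -> \sum_(i < n) (i < k) = k.
  move=> kn; rewrite -(big_mkord xpredT (fun i => (i < k) : nat)) (@big_cat_nat _ _ _ k) //=.
  rewrite (eq_big_nat _ _ (F2 := fun=> 1)); last by move=> i hi; have -> : i < k by lia.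
  rewrite [X in _ + X]big_nat_cond [X in _ + X]big1; last first.
    by move=> i hi; have -> : (i < k) = false by lia.
  by rewrite sum_nat_const_nat subn0 muln1 addn0.
have sum0 n : \sum_(i < n.+1) (0 < i) = n.
  by rewrite big_ord_recl add0n (eq_bigr (fun=> 1)) // sum_nat_const card_ord muln1.
have sum4 (F : bool * bool -> nat) : \sum_l F l =
    F (true, true) + F (true, false) + (F (false, true) + F (false, false)).
  rewrite (eq_bigr (fun l => F (l.1, l.2))); last by case.
  by rewrite -(pair_big xpredT xpredT (fun a b => F (a, b))) /= !big_bool.
rewrite card_sig -sum1_card big_mkcond /=.
rewrite (eq_bigr (fun vl : gvert p q * (bool * bool) => leaves_at vl.1.1 vl.1.2 vl.2 : nat));
  last first.
  by case=> v l _; rewrite inE leavesE /=; case: ifP.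
rewrite -(pair_big xpredT xpredT (fun (v : gvert p q) (l : bool * bool) =>
  leaves_at v.1 v.2 l : nat)) /=.
rewrite (eq_bigr (fun v : gvert p q => ((v.1 < p) + (0 < v.1)) + ((v.2 < q) + (0 < v.2))));
  last first.
  by case=> x y _; rewrite sum4 /leaves_at /=; lia.
rewrite -(pair_big xpredT xpredT (fun (x : 'I_p.+1) (y : 'I_q.+1) =>
   ((x < p) + (0 < x)) + ((y < q) + (0 < y)))) /=.
under eq_bigr => x _ do rewrite big_split sum_nat_const card_ord /= big_split /= sumI // sum0.
by rewrite big_split /= sum_nat_const card_ord -big_distrr big_split /= sumI // sum0; lia.
Qed.

End Grid.

(** * Staircases and the shelling towards a corner *)

Section Relative.

Variables p q : nat.
Hypotheses (p0 : 0 < p) (q0 : 0 < q).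
Variables cx cy : bool.

Implicit Types (d : dart (Q p q)) (c : 'I_p * 'I_q) (v : gvert p q).

(** Coordinates counted from the corner chosen by [cx] and [cy], for vertices, labels, darts
    ([rxco], [ryco], [rlab]) and squares ([rcol], [rrow]). *)
Definition rx (x : nat) : nat := if cx then p - x else x.
Definition ry (y : nat) : nat := if cy then q - y else y.
Definition rl (l : letter bool) : letter bool := (l.1, l.2 (+) (if l.1 then cy else cx)).

Definition rxco d : nat := rx (xco d).
Definition ryco d : nat := ry (yco d).
Definition rlab d : letter bool := rl (glab d).

Definition rcol c : nat := if cx then p.-1 - c.1 else c.1.
Definition rrow c : nat := if cy then q.-1 - c.2 else c.2.

Lemma src_coord d d' : src d = src d' -> rxco d = rxco d' /\ ryco d = ryco d'.
Proof. by rewrite /= => e; rewrite /rxco /ryco /xco /yco e. Qed.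

Lemma rlK : involutive rl.
Proof. by case=> [a b]; rewrite /rl /= addbK. Qed.

Lemma rxK x : x <= p -> rx (rx x) = x.
Proof. by rewrite /rx; case: cx; lia. Qed.

Lemma ryK y : y <= q -> ry (ry y) = y.
Proof. by rewrite /ry; case: cy; lia. Qed.

Lemma rx_le x : x <= p -> rx x <= p. Proof. by rewrite /rx; case: cx; lia. Qed.
Lemma ry_le y : y <= q -> ry y <= q. Proof. by rewrite /ry; case: cy; lia. Qed.

Lemma leaves_at_rel x y l : x <= p -> y <= q ->
  leaves_at p q (rx x) (ry y) (rl l) = leaves_at p q x y l.
Proof.
by rewrite /rx /ry /rl /leaves_at; case: l => [[] []]; case: cx; case: cy => /=; lia.
Qed.

Lemma rdartP d : [/\ rxco d <= p, ryco d <= q & leaves_at p q (rxco d) (ryco d) (rlab d)].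
Proof. by have [? ? ?] := gdartP d; rewrite leaves_at_rel ?rx_le ?ry_le. Qed.

Lemma rdart_eq d d' : rxco d = rxco d' -> ryco d = ryco d' -> rlab d = rlab d' -> d = d'.
Proof.
have [hx hy _] := gdartP d; have [hx' hy' _] := gdartP d'.
move=> eu ew ek; apply: gdart_eq; last by rewrite -[LHS]rlK -[RHS]rlK; congr rl.
  by rewrite -(rxK hx) -(rxK hx'); congr rx.
by rewrite -(ryK hy) -(ryK hy'); congr ry.
Qed.

Lemma xstep_rel x y l : x <= p -> y <= q -> leaves_at p q x y l ->
  rx (xstep x l) = xstep (rx x) (rl l) /\ ry (ystep y l) = ystep (ry y) (rl l).
Proof.
by rewrite /rx /ry /rl /leaves_at /xstep /ystep; case: l => [[] []]; case: cx; case: cy => /=;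
  lia.
Qed.

Lemma rflipE d : [/\ rxco (flip d) = xstep (rxco d) (rlab d),
  ryco (flip d) = ystep (ryco d) (rlab d) &
  rlab (flip d) = linv (rlab d)].
Proof.
have [x1 y1 l1] := gflipE d; have [hx hy hl] := gdartP d.
have [e1 e2] := xstep_rel hx hy hl.
by rewrite /rxco /ryco /rlab /= x1 y1 l1 e1 e2; case: (glab d) => a b; rewrite /rl /linv /= addNb.
Qed.

Definition rdart_at (u w : nat) (k : letter bool) : dart (Q p q) := dart_at q p0 (rx u) (ry w)
  (rl k).

Lemma rdart_atE u w k : u <= p -> w <= q -> leaves_at p q u w k ->
  [/\ rxco (rdart_at u w k) = u, ryco (rdart_at u w k) = w & rlab (rdart_at u w k) = k].
Proof.
move=> hu hw hk; have [|||x y l] := @dart_atE p q p0 (rx u) (ry w) (rl k).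
- exact: rx_le.
- exact: ry_le.
- by rewrite leaves_at_rel.
by rewrite /rxco /ryco /rlab /rdart_at x y l rxK // ryK // rlK.
Qed.

(** Seen from the corner, squares lie on the right of darts or on their left according to
    whether the change of coordinates preserves orientation. *)
Definition ron_cell (x y : nat) (l : letter bool) (i j : nat) : bool :=
  if cx (+) cy then
    match l with
    | (false, true) => (i == x) && (j == y)
    | (true, true) => (i.+1 == x) && (j == y)
    | (false, false) => (i.+1 == x) && (j.+1 == y)
    | (true, false) => (i == x) && (j.+1 == y)
    end
  else on_cell x y l i j.

Lemma rsideE d c : (side d == Some c) = ron_cell (rxco d) (ryco d) (rlab d) (rcol c) (rrow c).
Proof.
rewrite gsideE; have := gdartP d; have := (ltn_ord c.1, ltn_ord c.2).
rewrite /ron_cell /on_cell /rxco /ryco /rlab /rcol /rrow /rx /ry /rl /leaves_at.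
by case: (glab d) => [[] []]; case: cx; case: cy => /= -[h1 h2] [hx hy hl];
  apply/andP/andP => -[/eqP e1 /eqP e2]; split; apply/eqP; lia.
Qed.

Lemma rcol_lt c : rcol c < p. Proof. have := ltn_ord c.1; rewrite /rcol; case: cx; lia. Qed.
Lemma rrow_lt c : rrow c < q. Proof. have := ltn_ord c.2; rewrite /rrow; case: cy; lia. Qed.

Lemma rcell_ex a b : a < p -> b < q -> exists c, rcol c = a /\ rrow c = b.
Proof.
move=> ha hb.
have ha' : (if cx then p.-1 - a else a) < p by case: cx; lia.
have hb' : (if cy then q.-1 - b else b) < q by case: cy; lia.
by exists (Ordinal ha', Ordinal hb'); rewrite /rcol /rrow /=; case: cx; case: cy; lia.
Qed.

Lemma rcell_inj c c' : rcol c = rcol c' -> rrow c = rrow c' -> c = c'.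
Proof.
case: c c' => [[i hi] [j hj]] [[i' hi'] [j' hj']]; rewrite /rcol /rrow /= => e1 e2.
by congr (_, _); apply/val_inj => /=; move: e1 e2; case: cx; case: cy; lia.
Qed.

Definition rturn (k : letter bool) : letter bool :=
  if cx (+) cy then linv (turn_right k) else turn_right k.

Lemma rnxtE d c : side d = Some c -> [/\ rxco (nxt d) = xstep (rxco d) (rlab d),
  ryco (nxt d) = ystep (ryco d) (rlab d) & rlab (nxt d) = rturn (rlab d)].
Proof.
move=> sd; have l1 := gnxt_cell sd; have [x1 y1 _] := gnxtE d.
have [hx hy hl] := gdartP d; have [e1 e2] := xstep_rel hx hy hl.
rewrite /rxco /ryco /rlab /= x1 y1 l1 e1 e2; split=> //.
by rewrite /rturn /rl /turn_right /linv; case: (glab d) => [[] []]; case: cx; case: cy.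
Qed.

(** Cells are numbered column after column from the corner; a vertex or an edge has the
    number of the first cell that contains it.  Truncated predecessors deal with the two sides
    of the grid through the corner. *)
Definition number (a b : nat) : nat := a * q + b.

Lemma leq_number a b a' b' : a <= a' -> b <= b' -> number a b <= number a' b'.
Proof. by move=> ha hb; rewrite /number leq_add // leq_mul2r ha orbT. Qed.

Lemma number_inj a b a' b' : b < q -> b' < q -> number a b = number a' b' -> a = a' /\ b = b'.
Proof.
rewrite /number => hb hb' e; have eqa : a = a'.
  by have := congr1 (divn^~ q) e; rewrite !divnMDl // !divn_small // !addn0.
by split=> //; rewrite eqa in e; lia.
Qed.

Definition vert_number v : nat := number (rx v.1).-1 (ry v.2).-1.
Definition cell_number c : nat := number (rcol c) (rrow c).
Definition first_col d : nat := if (rlab d).1 then (rxco d).-1 else if (rlab d).2 then rxco d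
  else (rxco d).-1.
Definition first_row d : nat := if (rlab d).1 then if (rlab d).2 then ryco d else (ryco d).-1
  else (ryco d).-1.
Definition dart_number d : nat := number (first_col d) (first_row d).

Lemma first_col_lt d : first_col d < p.
Proof. by have [] := rdartP d; rewrite /first_col /leaves_at; case: (rlab d) => [[] []] /=;
  lia. Qed.
Lemma first_row_lt d : first_row d < q.
Proof. by have [] := rdartP d; rewrite /first_row /leaves_at; case: (rlab d) => [[] []] /=;
  lia. Qed.

Lemma dart_number_flip d : dart_number (flip d) = dart_number d.
Proof.
have [hu hw hk] := rdartP d; have [u1 w1 k1] := rflipE d.
rewrite /dart_number /first_col /first_row u1 w1 k1; move: hu hw hk;
  rewrite /xstep /ystep /linv /leaves_at.
by case: (rlab d) => [[] []] /= hu hw hk; congr number; lia.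
Qed.

Lemma vert_number_src d : vert_number (src d) <= dart_number d.
Proof.
apply: leq_number; rewrite -/(xco d) -/(yco d) -/(rxco d) -/(ryco d) /first_col /first_row;
  by have [] := rdartP d; case: (rlab d) => [[] []] /=; lia.
Qed.

Lemma dart_number_side d c : side d = Some c -> dart_number d <= cell_number c.
Proof.
move/eqP; rewrite rsideE /dart_number /cell_number => h; apply: leq_number; move: h;
  rewrite /first_col /first_row /ron_cell /on_cell;
  by case: (cx (+) cy); case: (rlab d) => [[] []] /=; lia.
Qed.

Lemma cell_number_inj : injective cell_number.
Proof. by move=> c c' /number_inj[]; rewrite ?rrow_lt //; apply: rcell_inj. Qed.

Lemma cell_number_ex t : t < p * q -> exists c, cell_number c = t.
Proof.
move=> ht; have [||c [ec1 ec2]] := @rcell_ex (t %/ q) (t %% q).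
- by rewrite ltn_divLR.
- by rewrite ltn_mod.
by exists c; rewrite /cell_number /number ec1 ec2 -divn_eq.
Qed.

Lemma cell_number_lt c : cell_number c < p * q.
Proof. have := rcol_lt c; have := rrow_lt c; rewrite /cell_number /number; nia. Qed.

Lemma dart_number_lt d : dart_number d < p * q.
Proof. have := first_col_lt d; have := first_row_lt d; rewrite /dart_number /number; nia. Qed.

(** With [dart_number_side], the number of an edge is the smaller of the numbers of the cells on
    its two sides: all that the shelling steps use about edges. *)
Lemma first_side d : exists2 c,
  cell_number c = dart_number d & side d = Some c \/ side (flip d) = Some c.
Proof.
have [c [e1 e2]] := rcell_ex (first_col_lt d) (first_row_lt d).
exists c; first by rewrite /cell_number e1 e2.
suff : (side d == Some c) || (side (flip d) == Some c).
  by case/orP=> /eqP; [left|right].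
rewrite !rsideE; have [-> -> ->] := rflipE d; have [hu hw hk] := rdartP d.
rewrite e1 e2; move: hu hw hk;
  rewrite /leaves_at /first_col /first_row /ron_cell /on_cell /xstep /ystep /linv.
by case: (cx (+) cy); case: (rlab d) => [[] []] /= hu hw hk; lia.
Qed.

Lemma side_flipN d c : side d = Some c -> side (flip d) <> Some c.
Proof.
move/eqP => h /eqP; apply/negP; move: h.
rewrite !rsideE; have [-> -> ->] := rflipE d; have [] := rdartP d.
rewrite /leaves_at /ron_cell /on_cell /xstep /ystep /linv.
by case: (cx (+) cy); case: (rlab d) => [[] []] /=; lia.
Qed.

Lemma gvert_rel v v' : rx v.1 = rx v'.1 -> ry v.2 = ry v'.2 -> v = v'.
Proof.
case: v v' => [[x hx] [y hy]] [[x' hx'] [y' hy']]; rewrite /rx /ry /= => e1 e2.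
by apply: gvert_eq => /=; move: e1 e2; case: cx; case: cy; lia.
Qed.

Definition rorigin v : Prop := rx v.1 = 0 /\ ry v.2 = 0.

Lemma first_dart v : ~ rorigin v -> exists2 d : dart (Q p q),
  gsrc d = v & dart_number d = vert_number v.
Proof.
move=> nb; have hu : rx v.1 <= p by apply: rx_le; rewrite -ltnS ltn_ord.
have hw : ry v.2 <= q by apply: ry_le; rewrite -ltnS ltn_ord.
have [u0|u0] := posnP (rx v.1).
  have w0 : 0 < ry v.2 by rewrite lt0n; apply/eqP => w0; apply: nb.
  have [//|//|//|eu ew ek] := @rdart_atE (rx v.1) (ry v.2) (true, false).
  exists (rdart_at (rx v.1) (ry v.2) (true, false)); first exact: gvert_rel.
  by rewrite /dart_number /first_col /first_row /vert_number eu ew ek /= u0.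
have [//|//|//|eu ew ek] := @rdart_atE (rx v.1) (ry v.2) (false, false).
exists (rdart_at (rx v.1) (ry v.2) (false, false)); first exact: gvert_rel.
by rewrite /dart_number /first_col /first_row /vert_number eu ew ek.
Qed.

Variable b : vert (Q p q).
Hypothesis b_origin : rorigin b.

(** The union of the closed cells numbered less than [t].  The base vertex is added by hand for
    [t = 0], where it is all that remains. *)
Definition stair (t : nat) : subcplx (Q p q) :=
  @Defs.Sub (Q p q) [set v : gvert p q | (v == b) || (vert_number v < t)] [set d : gdart p q |
    dart_number d < t]
    [set c : 'I_p * 'I_q | cell_number c < t].

Lemma stair_closed t : closed_sub (stair t).
Proof.
split=> [d|d|d c sd]; rewrite !inE ?dart_number_flip //.
  by move=> h; rewrite (leq_ltn_trans (vert_number_src d) h) orbT.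
by apply: leq_ltn_trans; apply: dart_number_side.
Qed.

Lemma mem_bdarts_stair t d : (d \in bdarts (stair t)) =
  (dart_number d < t) && (if side d is Some c then t <= cell_number c else true).
Proof. by rewrite !inE; case: (side d) => [c|] //=; rewrite inE -leqNgt. Qed.

(** The cells numbered before [c] are all present and no later one is, so an edge of [c] lies on
    the boundary unless the cell across it precedes [c]. *)
Lemma bdarts_last d c : side d = Some c ->
  (flip d \in bdarts (stair (cell_number c).+1)) = (dart_number d == cell_number c).
Proof.
move=> sd; rewrite mem_bdarts_stair dart_number_flip ltnS (dart_number_side sd) andTb.
have [c' e1 [e2|e2]] := first_side d; last first.
  rewrite e2 e1; have := dart_number_side sd;
    have [e|ne] := eqVneq (dart_number d) (cell_number c); last by lia.
  by move: e; rewrite -e1 => /cell_number_inj e; case: (side_flipN sd); rewrite -e.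
move: e2; rewrite sd => -[e]; rewrite e e1 eqxx.
case sf: (side (flip d)) => [c''|//]; have := dart_number_side sf;
  rewrite dart_number_flip -e1 leq_eqVlt.
by case/orP=> [/eqP/cell_number_inj e'|-> //]; case: (side_flipN sd); rewrite sf e e'.
Qed.

Lemma arc_darts_last c :
  arc_darts (stair (cell_number c).+1) c = [set d : dart (Q p q) |
    dart_number d == cell_number c].
Proof.
apply/setP => d; rewrite inE [d \in [set _ | _]]inE.
have fK : flip (flip d) = d by apply: gflipK.
apply/andP/idP => [[_ /orP[]/andP[/eqP sd]]|/eqP e].
- by rewrite bdarts_last.
- by rewrite -[X in X \in bdarts _]fK bdarts_last // dart_number_flip.
split; first by rewrite inE e.
have [c' e1 [e2|e2]] := first_side d; rewrite e in e1; move: e1 => /cell_number_inj e1;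
  rewrite e1 in e2.
  by rewrite e2 eqxx bdarts_last // e eqxx.
rewrite e2 eqxx; apply/orP; right;
  rewrite -[X in X \in bdarts _]fK bdarts_last // dart_number_flip e.
exact: eqxx.
Qed.

(** The witness ends at the vertex of [c] furthest from the corner: it and its successor have no
    cell beyond them with a smaller number.  The other two edges have [c] as their first
    cell only on the sides of the grid through the corner, whence the last clause. *)
Lemma far_dart c : exists d, [/\ side d = Some c, dart_number d = cell_number c,
  dart_number (nxt d) = cell_number c &
  dart_number (nxt (nxt d)) != cell_number c ->
    dart_number (nxt (nxt (nxt d))) != cell_number c ->
  [/\ rxco (nxt (nxt (nxt d))) = rcol c, ryco (nxt (nxt (nxt d))) = rrow c,
    0 < rcol c & 0 < rrow c]].
Proof.
have ha := rcol_lt c; have hb := rrow_lt c.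
pose k : letter bool := (cx (+) cy, true).
pose u0 := if cx (+) cy then (rcol c).+1 else rcol c.
pose w0 := if cx (+) cy then rrow c else (rrow c).+1.
have [|||eu ew ek] := @rdart_atE u0 w0 k.
- by rewrite /u0; case: ifP => _ //; apply: ltnW.
- by rewrite /w0; case: ifP => _ //; apply: ltnW.
- by rewrite /leaves_at /u0 /w0 /k; case: (cx (+) cy).
set d := rdart_at u0 w0 k in eu ew ek.
have s0 : side d = Some c.
  apply/eqP; rewrite rsideE eu ew ek /u0 /w0 /k /ron_cell.
  by case: (cx (+) cy) => /=; rewrite !eqxx.
have s1 : side (nxt d) = Some c by rewrite -s0; apply: gside_nxt.
have s2 : side (nxt (nxt d)) = Some c by rewrite -s1; apply: gside_nxt.
have [u1 w1 k1] := rnxtE s0; have [u2 w2 k2] := rnxtE s1; have [u3 w3 k3] := rnxtE s2.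
exists d; split=> //.
- rewrite /dart_number /first_col /first_row eu ew ek /cell_number /u0 /w0 /k;
  by case: (cx (+) cy).
- rewrite /dart_number /first_col /first_row u1 w1 k1 eu ew ek /cell_number /u0 /w0 /k /rturn
  /turn_right /linv /xstep /ystep.
  by case: (cx (+) cy).
rewrite /dart_number /first_col /first_row u3 w3 k3 u2 w2 k2 u1 w1 k1 eu ew ek /cell_number /u0
  /w0 /k /rturn /turn_right.
rewrite /linv /xstep /ystep.
by case: (cx (+) cy) => /= h1 h2; split=> //; rewrite lt0n; apply/eqP => h;
  move: h1 h2; rewrite h eqxx.
Qed.

(** No cell around the vertex of [c] nearest to the corner comes after [c]. *)
Lemma near_vertex c d : rxco d = rcol c -> ryco d = rrow c -> 0 < rcol c -> 0 < rrow c ->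
  d \notin bdarts (stair (cell_number c).+1).
Proof.
move=> eu ew ha hb; rewrite mem_bdarts_stair negb_and.
have ha' := rcol_lt c; have hb' := rrow_lt c.
case e: (side d) => [c'|].
  apply/orP; right; rewrite -ltnNge ltnS; move/eqP: e; rewrite rsideE eu ew => h.
  apply: leq_number; move: h; rewrite /ron_cell /on_cell;
    by case: (cx (+) cy); case: (rlab d) => [[] []] /=; lia.
have [c' _ [e'|e']] := first_side d; first by rewrite e' in e.
move/eqP: e; rewrite (gside_NoneE d); move: eu ew; have [] := gdartP d.
rewrite /rxco /ryco /rlab /rx /ry /leaves_at /on_outer.
by case: (glab d) => [[] []] /=; case: cx; case: cy; lia.
Qed.

Lemma lt4_ind (P : nat -> Prop) : P 0 -> P 1 -> P 2 -> P 3 -> forall i, i < 4 -> P i.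
Proof. by move=> h0 h1 h2 h3 [|[|[|[|i]]]]. Qed.

(** The arc consists of the two far edges of [c], and of one or both near edges for squares along
    the sides of the grid through the corner. *)
Lemma meets_in_arc_last c : meets_in_arc (stair (cell_number c).+1) c.
Proof.
have ord d : side d = Some c -> order nxt d = 4.
  by move=> sd; have [o _] := gnxt_orbit_cell sd; rewrite -size_orbit; move: o => /= ->.
have [d [s0 m0 m1 near]] := far_dart c.
have s1 : side (nxt d) = Some c by rewrite -s0; apply: gside_nxt.
have s2 : side (nxt (nxt d)) = Some c by rewrite -s1; apply: gside_nxt.
have s3 : side (nxt (nxt (nxt d))) = Some c by rewrite -s2; apply: gside_nxt.
have [_ n4] := gnxt_orbit_cell s0.
have b0 := bdarts_last s0; have b1 := bdarts_last s1; have b2 := bdarts_last s2.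
have b3 := bdarts_last s3; rewrite m0 eqxx in b0; rewrite m1 eqxx in b1.
have vert d' k : 2 < k -> forall i, i < 4 ->
  src (iter i nxt d') \in bverts (stair (cell_number c).+1) ->
    exists2 j, j <= k & src (iter i nxt d') = src (iter j nxt d').
  by move=> k2 i i4 _; exists i => //; lia.
case e2: (dart_number (nxt (nxt d)) == cell_number c) b2 => b2;
  case e3: (dart_number (nxt (nxt (nxt d))) == cell_number c) b3 => b3.
- exists d, 4; rewrite (ord _ s0); split=> //; last exact: vert.
  exact: lt4_ind.
- exists d, 3; rewrite (ord _ s0); split=> //; last exact: vert.
  exact: lt4_ind.
- exists (nxt (nxt (nxt d))), 3; rewrite (ord _ s3); split=> //; last exact: vert.
  have n4' : nxt (nxt (nxt (nxt d))) = d by exact: n4.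
  by apply: lt4_ind; rewrite /iter ?n4'; [exact: b3|exact: b0|exact: b1|exact: b2].
exists d, 2; rewrite (ord _ s0); split=> //; first exact: lt4_ind.
have [//|//|u3 w3 ha hb] := near; first by rewrite e2.
  by rewrite e3.
apply: lt4_ind => [_|_|_|hv]; [by exists 0|by exists 1|by exists 2|exfalso].
move: hv; rewrite -[iter 3 nxt d]/(nxt (nxt (nxt d))) [_ \in bverts _]inE =>
  /andP[_ /orP[/existsP[d' /andP[d'b /eqP sd']]|/forallP h]].
  move: d'b; apply/negP; apply: near_vertex => //.
    by rewrite -u3; have [] := src_coord sd'.
  by rewrite -w3; have [] := src_coord sd'.
have d3S : nxt (nxt (nxt d)) \in sdarts (stair (cell_number c).+1) by rewrite inE ltnS
  (dart_number_side s3).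
by have /implyP/(_ d3S)/eqP := h (nxt (nxt (nxt d))).
Qed.

(** Each edge of a staircase is followed by another one around its first cell. *)
Lemma no_isolated t : isolated_darts (sdarts (stair t)) b = set0.
Proof.
apply/setP => d; rewrite !inE; apply/negP => /and4P[dt _ _ /forallP h].
have fK : flip (flip d) = d by apply: gflipK.
have [d' dd' [c nt sd]] : exists2 d', d' = d \/ d' = flip d & exists2 c,
  cell_number c < t & side d' = Some c.
  have [c e [s|s]] := first_side d; rewrite -e in dt; first by exists d; [left|exists c].
  by exists (flip d); [right|exists c].
have sn : side (nxt d') = Some c by rewrite -sd; apply: gside_nxt.
have nt' := leq_ltn_trans (dart_number_side sn) nt.
have src_n : src (nxt d') = tgt d' by apply: gnxt_src.
have := h (nxt d'); rewrite inE nt' src_n.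
have -> : (tgt d' == src d) || (tgt d' == tgt d).
  by case: dd' => ->; rewrite ?eqxx ?orbT // /tgt fK eqxx.
have ln := gnxt_cell sd.
have n1 : nxt d' <> d'.
  by move=> e; move: ln; rewrite -[gnxt d']/(nxt d') e /turn_right; case: (glab d') => [[] []].
have n2 : nxt d' <> flip d'.
  move=> e; have [_ _ lf] := gflipE d'; move: ln; rewrite -[gnxt d']/(nxt d') e.
  by rewrite -[flip d']/(gflip d') lf /turn_right /linv; case: (glab d') => [[] []].
by case: dd' => ed; rewrite ed ?fK in n1 n2 *; case/orP => /eqP.
Qed.

(** The edges whose first cell is [c] are those of the arc, so that taking the arc away leaves
    exactly the edges of the smaller staircase. *)
Lemma stair_step c : remove_cell b (stair (cell_number c).+1) (stair (cell_number c)).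
Proof.
exists c; split; [by rewrite inE|exact: meets_in_arc_last|].
have eA : sdarts (stair (cell_number c).+1) :\: arc_darts (stair (cell_number c).+1) c =
  sdarts (stair (cell_number c)).
  by rewrite arc_darts_last; apply/setP => d; rewrite !inE ltnS ltn_neqAle.
cbv zeta; rewrite eA no_isolated setD0; congr (@Defs.Sub (Q p q)); apply/setP => x; rewrite !inE.
- have [->|xb] := eqVneq x b; first by [].
  rewrite /=; apply/idP/andP => [hx|[_ /existsP[d]]].
    split; first exact: ltnW.
    have [|d sd md] := @first_dart x.
      move=> -[h1 h2]; case/eqP: xb; apply: gvert_rel; rewrite ?h1 ?h2; first by case: b_origin.
      by case: b_origin.
    by apply/existsP; exists d; rewrite inE md hx; apply/eqP.
  by rewrite inE => /andP[hd /eqP <-]; apply: leq_ltn_trans hd; apply: vert_number_src.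
by rewrite ltnS [cell_number x < cell_number c]ltn_neqAle (inj_eq cell_number_inj).
Qed.

Lemma stair0 : stair 0 = @point (Q p q) b.
Proof. by congr (@Defs.Sub (Q p q)); apply/setP => x; rewrite !inE ?orbF. Qed.

Lemma stair_full : stair (p * q) = full (Q p q).
Proof.
congr (@Defs.Sub (Q p q)); apply/setP => x; rewrite !inE ?cell_number_lt ?dart_number_lt //.
rewrite /vert_number /number; have := rx_le (ltn_ord x.1); have := ry_le (ltn_ord x.2).
have : (rx x.1).-1 < p by have := @rx_le x.1; have := ltn_ord x.1; lia.
have : (ry x.2).-1 < q by have := @ry_le x.2; have := ltn_ord x.2; lia.
move=> h1 h2 _ _; apply/orP; right; nia.
Qed.

Lemma stair_base t : b \in bverts (stair t).
Proof.
rewrite !inE eqxx /=; case: t => [|t].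
  by apply/orP; right; apply/forallP => d; rewrite inE.
apply/orP; left; apply/existsP.
have [|||u0 w0 k0] := @rdart_atE 0 0 (cx (+) cy, true); rewrite ?/leaves_at //;
  first by case: (cx (+) cy).
exists (rdart_at 0 0 (cx (+) cy, true)); apply/andP; split; last first.
  by apply/eqP; apply: gvert_rel; rewrite -/(xco _) -/(yco _) -/(rxco _) -/(ryco _) ?u0 ?w0;
    case: b_origin.
rewrite mem_bdarts_stair /dart_number /first_col /first_row u0 w0 k0 /=.
have -> /= : number (if cx (+) cy then 0 else 0) (if cx (+) cy then 0 else 0) = 0.
  by case: ifP; rewrite /number mul0n.
case e: (gside _) => [c|//]; move/eqP: e.
rewrite (rsideE (rdart_at 0 0 (cx (+) cy, true))) u0 w0 k0 /ron_cell /on_cell.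
by case: (cx (+) cy); rewrite ?andbF.
Qed.

Local Notation north := ((true, true) : letter bool).
Local Notation east := ((false, true) : letter bool).

(** First along the side of the grid through the corner, then along a row: in a staircase, no
    vertex of such a path has a greater number than its end. *)
Definition rpath (u w : nat) : seq (dart (Q p q)) :=
  mkseq (fun j => rdart_at 0 j north) w ++ mkseq (fun i => rdart_at i w east) u.

Definition base_path (v : vert (Q p q)) : seq (dart (Q p q)) := rpath (rx v.1) (ry v.2).

Lemma rpath0S w : rpath 0 w.+1 = rpath 0 w ++ [:: rdart_at 0 w north].
Proof. by rewrite /rpath mkseqS -cats1 [mkseq _ 0]/= !cats0. Qed.

Lemma rpathS u w : rpath u.+1 w = rpath u w ++ [:: rdart_at u w east].
Proof. by rewrite /rpath mkseqS -cats1 catA. Qed.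

Lemma flipK_grid : involutive (@flip (Q p q)). Proof. exact: gflipK. Qed.

Lemma rdart_at_number u w k : u <= p -> w <= q -> leaves_at p q u w k ->
  dart_number (rdart_at u w k) =
  number (if k.1 then u.-1 else if k.2 then u else u.-1)
      (if k.1 then if k.2 then w else w.-1 else w.-1).
Proof. by move=> hu hw hk; have [e1 e2 e3] := rdart_atE hu hw hk;
  rewrite /dart_number /first_col /first_row e1 e2 e3. Qed.

Lemma tgt_rdart_at u w k v : u <= p -> w <= q -> leaves_at p q u w k ->
  rx v.1 = xstep u k -> ry v.2 = ystep w k -> tgt (rdart_at u w k) = v.
Proof.
move=> hu hw hk e1 e2; have [u0 w0 k0] := rdart_atE hu hw hk;
  have [u1 w1 _] := rflipE (rdart_at u w k).
apply: gvert_rel; first by rewrite e1 -[LHS]/(rxco (flip (rdart_at u w k))) u1 u0 k0.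
by rewrite e2 -[LHS]/(ryco (flip (rdart_at u w k))) w1 w0 k0.
Qed.

Lemma src_rdart_at u w k v : u <= p -> w <= q -> leaves_at p q u w k ->
  rx v.1 = u -> ry v.2 = w -> src (rdart_at u w k) = v.
Proof.
move=> hu hw hk e1 e2; have [u0 w0 k0] := rdart_atE hu hw hk.
apply: gvert_rel; first by rewrite e1 -[LHS]/(rxco (rdart_at u w k)) u0.
by rewrite e2 -[LHS]/(ryco (rdart_at u w k)) w0.
Qed.

Definition rvert_at (u w : nat) : vert (Q p q) := (inord (rx u), inord (ry w)).

Lemma rvert_atE u w : u <= p -> w <= q -> rx (rvert_at u w).1 = u /\ ry (rvert_at u w).2 = w.
Proof. by move=> hu hw; rewrite /rvert_at /= !inordK ?ltnS ?rx_le ?ry_le // rxK // ryK. Qed.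

Lemma rvert_atK v : rvert_at (rx v.1) (ry v.2) = v.
Proof.
have [||e1 e2] := @rvert_atE (rx v.1) (ry v.2); last exact: gvert_rel.
  by rewrite rx_le // -ltnS.
by rewrite ry_le // -ltnS.
Qed.

Lemma walk_step t u w k s : u <= p -> w <= q -> leaves_at p q u w k ->
  dart_number (rdart_at u w k) < t -> walk (stair t) b s (rvert_at u w) ->
  walk (stair t) b (s ++ [:: rdart_at u w k]) (rvert_at (xstep u k) (ystep w k)).
Proof.
move=> hu hw hk hM ws; apply/(walk_cat _ _ _ _ (stair_closed t) flipK_grid).
exists (rvert_at u w) => //.
have -> : rvert_at u w = src (rdart_at u w k) by have [e1 e2] := rvert_atE hu hw;
  rewrite (src_rdart_at hu hw hk e1 e2).
have hu' : xstep u k <= p by move: hk; rewrite /xstep /leaves_at; case: (k) => [[] []] //=; lia.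
have hw' : ystep w k <= q by move: hk; rewrite /ystep /leaves_at; case: (k) => [[] []] //=; lia.
have -> : rvert_at (xstep u k) (ystep w k) = tgt (rdart_at u w k).
  by have [e1 e2] := rvert_atE hu' hw'; rewrite (tgt_rdart_at hu hw hk e1 e2).
by apply: (walk1 (stair_closed t)); rewrite inE.
Qed.

Lemma rpath_walk t u w : u <= p -> w <= q -> (u == 0) && (w == 0) || (number u.-1 w.-1 < t) ->
  walk (stair t) b (rpath u w) (rvert_at u w).
Proof.
elim: u => [|u IHu] hu.
  elim: w => [|w IHw] hw ht.
    rewrite /rpath /= inE eqxx /=; apply/eqP; have [e1 e2] := rvert_atE hu hw.
    by apply: gvert_rel; rewrite ?e1 ?e2; case: b_origin.
  rewrite rpath0S; apply: walk_step => //; [exact: ltnW|by rewrite rdart_at_number // ltnW|].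
  apply: IHw; first exact: ltnW.
  move: ht; rewrite /= => ht; apply/orP; right; apply: leq_ltn_trans ht.
  by rewrite leq_number // leq_pred.
move=> hw; rewrite /= => ht; rewrite rpathS; apply: walk_step => //;
  [exact: ltnW|by rewrite rdart_at_number // ltnW|].
apply: IHu => //; first exact: ltnW.
by apply/orP; right; apply: leq_ltn_trans ht; rewrite leq_number // leq_pred.
Qed.

Lemma base_path_walk t v : v \in sverts (stair t) -> walk (stair t) b (base_path v) v.
Proof.
rewrite inE => hv; rewrite -{2}(rvert_atK v); apply: rpath_walk.
- by rewrite rx_le // -ltnS.
- by rewrite ry_le // -ltnS.
by case/orP: hv => [/eqP ->|->]; [case: b_origin => -> ->|rewrite orbT].
Qed.

(** The border walk of the square starts with one of the two sides at its nearest vertex,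
    depending on orientation; the two cases give the homotopy in opposite senses. *)
Lemma rsquare t u w : u < p -> w < q -> number u w < t ->
  homotopic (stair t) (rvert_at u w) (rvert_at u.+1 w.+1)
    [:: rdart_at u w east; rdart_at u.+1 w north] [:: rdart_at u w north; rdart_at u w.+1 east].
Proof.
move=> hu hw ht; have hu' := ltnW hu; have hw' := ltnW hw.
have [|||eu ew ek] := @rdart_atE u w (~~ (cx (+) cy), true) => //; first by rewrite /leaves_at;
  case: (cx (+) cy).
set d := rdart_at u w _ in eu ew ek.
have [c [ec1 ec2]] := rcell_ex hu hw.
have s0 : side d = Some c.
  by apply/eqP; rewrite rsideE eu ew ek ec1 ec2 /ron_cell; case: (cx (+) cy); rewrite /= !eqxx.
have s1 : side (nxt d) = Some c by rewrite -s0; apply: gside_nxt.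
have s2 : side (nxt (nxt d)) = Some c by rewrite -s1; apply: gside_nxt.
have s3 : side (nxt (nxt (nxt d))) = Some c by rewrite -s2; apply: gside_nxt.
have [o n4] := gnxt_orbit_cell s0.
have [u1 w1 k1] := rnxtE s0; have [u2 w2 k2] := rnxtE s1; have [u3 w3 k3] := rnxtE s2.
have [u5 w5 k5] := rflipE (nxt (nxt d)); have [u6 w6 k6] := rflipE (nxt (nxt (nxt d))).
have cS : c \in scells (stair t) by rewrite inE /cell_number ec1 ec2.
have src_d : src d = rvert_at u w.
  by have [e1 e2] := rvert_atE hu' hw'; apply: (src_rdart_at _ _ _ e1 e2) => //;
    rewrite /leaves_at; case: (cx (+) cy).
have tgt_d : tgt (nxt d) = rvert_at u.+1 w.+1.
  have [e1 e2] := @rvert_atE u.+1 w.+1 hu hw.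
  have [u7 w7 _] := rflipE (nxt d).
  apply: gvert_rel; rewrite ?e1 ?e2.
    rewrite -[LHS]/(rxco (flip (nxt d))) u7 u1 k1 eu ek /rturn /turn_right /linv /xstep.
    by case: (cx (+) cy).
  rewrite -[LHS]/(ryco (flip (nxt d))) w7 w1 k1 ew ek /rturn /turn_right /linv /ystep.
  by case: (cx (+) cy).
have [E1 E2 E3] : [/\ nxt d = if cx (+) cy then rdart_at u.+1 w north else rdart_at u w.+1 east,
    flip (nxt (nxt (nxt d))) = rdart_at u w (cx (+) cy, true) &
    flip (nxt (nxt d)) = if cx (+) cy then rdart_at u w.+1 east else rdart_at u.+1 w north].
  have [//|//|//|a1 a2 a3] := @rdart_atE u.+1 w north;
    have [//|//|//|a4 a5 a6] := @rdart_atE u w.+1 east.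
  have [//|//||a7 a8 a9] := @rdart_atE u w (cx (+) cy, true); first by rewrite /leaves_at;
    case: (cx (+) cy).
  split; apply: rdart_eq.
  - rewrite u1 eu ek; case: (cx (+) cy); by rewrite ?a1 ?a4.
  - rewrite w1 ew ek; case: (cx (+) cy); by rewrite ?a2 ?a5.
  - rewrite k1 ek /rturn; case: (cx (+) cy); by rewrite ?a3 ?a6.
  - rewrite u6 u3 k3 u2 k2 u1 k1 eu ek a7 /rturn; by case: (cx (+) cy).
  - rewrite w6 w3 k3 w2 k2 w1 k1 ew ek a8 /rturn; by case: (cx (+) cy).
  - rewrite k6 k3 k2 k1 ek a9 /rturn; by case: (cx (+) cy).
  - rewrite u5 u2 k2 u1 k1 eu ek /rturn; case: (cx (+) cy); by rewrite ?a1 ?a4.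
  - rewrite w5 w2 k2 w1 k1 ew ek /rturn; case: (cx (+) cy); by rewrite ?a2 ?a5.
  by rewrite k5 k2 k1 ek /rturn; case: (cx (+) cy); rewrite ?a3 ?a6.
have H : homotopic (stair t) (rvert_at u w) (rvert_at u.+1 w.+1) [:: d; nxt d]
    [:: flip (nxt (nxt (nxt d))); flip (nxt (nxt d))].
  rewrite -src_d -tgt_d; apply: (square_homotopic flipK_grid (stair_closed t) s0 cS).
  - by rewrite -size_orbit; exact: (congr1 size o).
  - move=> i; have si : side (iter i nxt d) = Some c.
      by elim: i => [//|i IH]; rewrite iterS -IH; apply: gside_nxt.
    exact: (csub_side (stair_closed t) si cS).
  - by move=> i; rewrite iterS; apply: gnxt_src.
  by congr (@src (Q p q) _); exact: n4.
rewrite E2 E3 E1 /d in H; move: H; clear.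
by case: (cx (+) cy) => //; apply: Htp_sym.
Qed.

(** Pushing an edge parallel to the first side across the squares between it and that side. *)
Lemma base_path_north t u w : u <= p -> w < q -> number u.-1 w < t ->
  homotopic (stair t) b (rvert_at u w.+1) (rpath u w ++ [:: rdart_at u w north]) (rpath u w.+1).
Proof.
elim: u => [|u IH] hu hw ht; first by rewrite rpath0S; apply: Htp_refl.
rewrite !rpathS -catA; have hu' := ltnW hu; have hw' := ltnW hw.
have lw : number u w.-1 < t by apply: leq_ltn_trans ht; rewrite leq_number // leq_pred.
have lu : number u.-1 w < t by apply: leq_ltn_trans ht; rewrite leq_number // leq_pred.
have wp : walk (stair t) b (rpath u w) (rvert_at u w).
  apply: rpath_walk => //; apply/orP; right; apply: leq_ltn_trans lw;
    by rewrite leq_number // leq_pred.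
apply: Htp_trans (homotopic_catl flipK_grid (stair_closed t) wp (rsquare hu hw ht)) _.
rewrite -[X in _ ++ X]cat1s catA; apply: homotopic_catr (IH hu' hw lu).
- exact: flipK_grid.
- exact: stair_closed.
have := walk1 (stair_closed t) (_ : rdart_at u w.+1 east \in sdarts (stair t)).
have [e1 e2] := @rvert_atE u w.+1 hu' hw; have [e3 e4] := @rvert_atE u.+1 w.+1 hu hw.
rewrite (@src_rdart_at u w.+1 east _ hu' hw hu e1 e2) (@tgt_rdart_at u w.+1 east _ hu' hw hu e3
  e4); apply.
by rewrite inE rdart_at_number.
Qed.

(** Along a row the paths extend each other; the other direction is [base_path_north]. *)
Lemma base_path_dart t d : d \in sdarts (stair t) ->
  homotopic (stair t) b (tgt d) (base_path (src d) ++ [:: d]) (base_path (tgt d)).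
Proof.
wlog kd : d / (rlab d).2.
  move=> ih dS; case e: (rlab d).2; first exact: ih.
  have fS : flip d \in sdarts (stair t) by rewrite (csub_flip (stair_closed t)).
  have [_ _ kf] := rflipE d.
  have kf2 : (rlab (flip d)).2 by rewrite kf; move: e; rewrite /linv; case: (rlab d) => ? [].
  have h := ih (flip d) kf2 fS.
  have := base_path_flip flipK_grid (stair_closed t) fS _ h; rewrite !flipK_grid; apply.
  exact: base_path_walk (csub_src (stair_closed t) fS).
rewrite inE => dS; have [hu hw hk] := rdartP d; have [u1 w1 k1] := rflipE d.
have eK : rlab d = north \/ rlab d = east by case: (rlab d) kd => [[] []]; [left| |right|].
have e_d : d = rdart_at (rxco d) (ryco d) (rlab d).
  by have [e1 e2 e3] := rdart_atE hu hw hk; apply: rdart_eq; rewrite ?e1 ?e2 ?e3.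
rewrite /base_path -[rx (src d).1]/(rxco d) -[ry (src d).2]/(ryco d).
rewrite -[rx (tgt d).1]/(rxco (flip d)) -[ry (tgt d).2]/(ryco (flip d)).
case: eK => eK; rewrite eK in e_d hk u1 w1; last first.
  have -> : rxco (flip d) = (rxco d).+1 by exact: u1.
  have -> : ryco (flip d) = ryco d by exact: w1.
  by rewrite rpathS -e_d; apply: Htp_refl.
have -> : rxco (flip d) = rxco d by exact: u1.
have -> : ryco (flip d) = (ryco d).+1 by exact: w1.
have -> : tgt d = rvert_at (rxco d) (ryco d).+1.
  have [e1 e2] := @rvert_atE (rxco d) (ryco d).+1 hu hk.
  by rewrite -(@tgt_rdart_at (rxco d) (ryco d) north _ hu hw hk e1 e2) -e_d.
rewrite [X in _ ++ [:: X]]e_d; apply: base_path_north => //.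
by move: dS; rewrite /dart_number /first_col /first_row eK.
Qed.

Lemma stair_connected t : connected_sub (stair t).
Proof.
apply: (base_paths_connected flipK_grid (stair_closed t) (b := b) (P := base_path)).
  by rewrite inE eqxx.
exact: base_path_walk.
Qed.

Lemma stair_simply_connected t : simply_connected_sub (stair t).
Proof.
apply: (base_paths_simply_connected flipK_grid (stair_closed t)
  (@base_path_walk t) (@base_path_dart t)).
Qed.

(** Two boundary edges in the same column and in the same sense would enclose a gap in that
    column of the staircase; the same holds for rows.  So the boundary walk injects into pairs
    of a direction and a coordinate. *)
Lemma stair_blength t : blength (stair t) <= 4 * (p.+1 + q.+1).
Proof.
pose f (d : gdart p q) : (bool * bool) * ('I_p.+1 + 'I_q.+1) :=
  (glab d, if (glab d).1 then inr (gsrc d).2 else inl (gsrc d).1).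
have finj : {in bdarts (stair t) &, injective f}.
  have no_lt d d' : d \in bdarts (stair t) -> d' \in bdarts (stair t) -> rlab d = rlab d' ->
      (if (rlab d).1 then ryco d = ryco d' else rxco d = rxco d') ->
      ~~ (if (rlab d).1 then rxco d < rxco d' else ryco d < ryco d').
    rewrite !mem_bdarts_stair => /andP[h1 h2] /andP[h3 h4] ek euw; apply/negP => hlt.
    have [hu hw hk] := rdartP d; have [hu' hw' hk'] := rdartP d'.
    have ha := first_col_lt d'; have hb := first_row_lt d'; have ha1 := first_col_lt d;
      have hb1 := first_row_lt d.
    have [c [e1 e2]] := rcell_ex ha hb.
    have [||c' [e3 e4]] := @rcell_ex (if (rlab d).1 then rxco d else first_col d) (if (rlab d).1
      then first_row d else ryco d).
    - by move: hlt; case: ifP => // _; lia.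
    - by move: hlt; case: ifP => // _; lia.
    have : (side d' == Some c) || (side d == Some c').
      rewrite !rsideE e1 e2 e3 e4; move: hk hk' euw hlt;
        rewrite /first_col /first_row /ron_cell /on_cell -ek /leaves_at.
      by case: (cx (+) cy); case: (rlab d) => [[] []] /= ? ? ? ?; lia.
    case/orP=> /eqP sd.
      by move: h4; rewrite sd /cell_number e1 e2 leqNgt -/(dart_number d') h3.
    move: h2; rewrite sd leqNgt (leq_ltn_trans _ h3) //; apply: leq_number.
      rewrite e3; move: hk hk' euw hlt; rewrite /first_col -ek /leaves_at;
        by case: (rlab d) => [[] []] /=; lia.
    rewrite e4; move: hk hk' euw hlt; rewrite /first_row -ek /leaves_at;
      by case: (rlab d) => [[] []] /=; lia.
  move=> d d' db db'; rewrite /f => -[el exy].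
  have ek : rlab d = rlab d' by rewrite /rlab el.
  have ek1 : (rlab d).1 = (glab d).1 by [].
  have l1 := no_lt d d' db db' ek; have l2 := no_lt d' d db' db (esym ek).
  rewrite -ek in l2; rewrite ek1 in l1 l2.
  move: exy l1 l2; rewrite -el; case: ifP => _ [exy] l1 l2.
    have ew : ryco d = ryco d' by rewrite /ryco /yco exy.
    by apply: rdart_eq => //; have := l1 ew; have := l2 (esym ew); lia.
  have eu : rxco d = rxco d' by rewrite /rxco /xco exy.
  by apply: rdart_eq => //; have := l1 eu; have := l2 (esym eu); lia.
rewrite /blength -(card_in_imset finj); apply: leq_trans (max_card _) _.
by rewrite card_prod card_sum !card_ord card_prod card_bool.
Qed.

Lemma grid_shelling : exists S, based_shelling b (p * q) S /\
  forall j, blength (S j) <= 4 * (p.+1 + q.+1).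
Proof.
exists (fun j => stair (p * q - j)); split=> [|j]; last exact: stair_blength.
split=> [||j _|j _|j _|j _|j hj].
- by rewrite subn0 stair_full.
- by rewrite subnn stair0.
- exact: stair_closed.
- exact: stair_connected.
- exact: stair_simply_connected.
- exact: stair_base.
left; have [|c ec] := @cell_number_ex (p * q - j.+1); first by lia.
by have -> : p * q - j = (cell_number c).+1 by [lia]; rewrite -ec; apply: stair_step.
Qed.

End Relative.

(** * The grid as a van Kampen diagram *)

Lemma grid_disk_diagram p q : 0 < p -> 0 < q -> disk_diagram (Q p q).
Proof.
move=> p0 q0; have b0 : @rorigin p q false false (ord0, ord0) by [].
split.
- exact: gflipK.
- exact: gflipN.
- exact: gnxt_inj.
- exact: gnxt_src.
- exact: grot.
- exact: gside_fconnect.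
- by move=> _; apply: gside_onto.
- by rewrite -(stair_full p0 q0 false false (ord0, ord0)); apply: stair_connected.
- by rewrite -(stair_full p0 q0 false false (ord0, ord0)); apply: stair_simply_connected.
change (#|{: 'I_p.+1 * 'I_q.+1}| + #|{: 'I_p * 'I_q}|.+1 = #|{: gdart p q}|./2 + 2).
by rewrite (card_gdart p0 q0) !card_prod !card_ord; lia.
Qed.

Lemma grid_van_kampen p q : 0 < p -> 0 < q ->
  van_kampen commutator_rels (@Qlab p q) (grid_word p q).
Proof.
move=> p0 q0; split.
- exact: grid_disk_diagram.
- by move=> d; have [] := gflipE d.
- move=> d c sd; exists [:: la; lb; lA; lB].
  have [o _] := gnxt_orbit_cell sd; have l1 := gnxt_cell sd.
  have s1 := sd; rewrite -[side d]/(gside d) -gside_nxt in s1.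
  have s2 := s1; rewrite -gside_nxt in s2; have l2 := gnxt_cell s1; have l3 := gnxt_cell s2.
  have -> : [seq Qlab i | i <- orbit nxt d] = [:: glab d; turn_right (glab d);
      turn_right (turn_right (glab d)); turn_right (turn_right (turn_right (glab d)))].
    by rewrite -[orbit nxt d]/(orbit (@gnxt p q) d) o /= /Qlab l3 l2 l1.
  pose n := match glab d with (true, true) => 0 | (false, true) => 1
    | (true, false) => 2 | (false, false) => 3 end.
  exists n; split; first by rewrite inE.
    by rewrite /n; case: (glab d) => [[] []].
  right; rewrite /n; case: (glab d) => [[] []]; by [].
left; exists (outer q p0 0); first by apply: gside_outer; lia.
by rewrite -(outer_word p0 q0) -(outer_orbit p0 q0).
Qed.

Lemma corner_rorigin p q (v : vert (Q p q)) : corner v -> exists cx cy, rorigin cx cy v.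
Proof.
rewrite /corner => /andP[/orP[]/eqP e1 /orP[]/eqP e2].
- by exists false, false; rewrite /rorigin e1 e2.
- by exists false, true; rewrite /rorigin e1 e2 /rx /ry /= subnn.
- by exists true, false; rewrite /rorigin e1 e2 /rx /ry /= subnn.
by exists true, true; rewrite /rorigin e1 e2 /rx /ry /= !subnn.
Qed.

Lemma corner_shelling p q (v : vert (Q p q)) : 0 < p -> 0 < q -> corner v ->
  exists N S, based_shelling v N S /\ forall j, blength (S j) <= 4 * (p.+1 + q.+1).
Proof.
move=> p0 q0 /corner_rorigin[cx [cy bv]]; exists (p * q).
by have := grid_shelling p0 q0 bv.
Qed.

Lemma grid_perimeter p q : 0 < p -> 0 < q -> p <= blength (full (Q p q)).
Proof.
move=> p0 q0; have u := outer_walk_uniq p0 q0.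
apply: (@leq_trans (size (mkseq (outer q p0) (p + q + p + q)))); first by rewrite size_mkseq; lia.
rewrite -(card_uniqP u); apply/subset_leq_card/subsetP => d /mapP[k].
rewrite mem_iota => hk ->; have := @gside_outer p q p0 q0 k.
by rewrite !inE /= => ->.
Qed.

Lemma grid_bverts p q (v : gvert p q) : 0 < p -> 0 < q ->
  (v \in bverts (full (Q p q))) =
    [|| v.1 == 0 :> nat, v.1 == p :> nat, v.2 == 0 :> nat | v.2 == q :> nat].
Proof.
move=> p0 q0; have hx : v.1 <= p by rewrite -ltnS.
have hy : v.2 <= q by rewrite -ltnS.
have mk l : leaves_at p q v.1 v.2 l -> on_outer p q v.1 v.2 l -> v \in bverts (full (Q p q)).
  move=> hl ho; have [d [sd ld]] := gdart_ex hl.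
  rewrite !inE; apply/orP; left; apply/existsP; exists d.
  rewrite -[@src (Q p q) d]/(gsrc d) sd eqxx andbT !inE.
  have : gside d == None by rewrite gside_NoneE /xco /yco sd ld.
  by move=> /eqP /= ->.
apply/idP/idP => [|h].
  rewrite !inE => /orP[/existsP[d]|/forallP h].
    rewrite !inE /= => /andP[sN /eqP <-]; have [h1 h2 h3] := gdartP d.
    have : gside d == None by case: (gside d) sN => [c|//]; rewrite inE.
    rewrite gside_NoneE -/(xco d) -/(yco d); move: h1 h2 h3; rewrite /leaves_at /on_outer.
    by case: (glab d) => [[] []]; lia.
  have [->|y0] := eqVneq (nat_of_ord v.2) 0; first by rewrite !orbT.
  have [|d [sd _]] := @gdart_ex p q v (true, false); first by rewrite /leaves_at lt0n.
  by have := h d; rewrite inE -[@src (Q p q) d]/(gsrc d) sd eqxx.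
case/or4P: h => /eqP h.
- have [y0|y0] := posnP v.2.
    by apply: (mk (false, true)); rewrite /leaves_at /on_outer ?h ?y0.
  by apply: (mk (true, false)); rewrite /leaves_at /on_outer ?h ?y0.
- have [y0|y0] := ltnP v.2 q; first by apply: (mk (true, true));
  rewrite /leaves_at /on_outer ?h ?y0.
  by apply: (mk (false, false)); rewrite /leaves_at /on_outer; lia.
- have [x0|x0] := ltnP v.1 p; first by apply: (mk (false, true));
  rewrite /leaves_at /on_outer ?h ?x0.
  by apply: (mk (true, true)); rewrite /leaves_at /on_outer; lia.
have [x0|x0] := posnP v.1; last by apply: (mk (false, false));
  rewrite /leaves_at /on_outer ?h ?x0.
by apply: (mk (true, false)); rewrite /leaves_at /on_outer; lia.
Qed.

Lemma grid_deg_le4 p q (v : vert (Q p q)) : deg v <= 4.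
Proof.
pose f (d : gdart p q) := glab d.
have finj : {in [pred d : gdart p q | gsrc d == v] &, injective f}.
  move=> d d'; rewrite !inE => /eqP e /eqP e' el.
  by apply: gdart_eq => //; rewrite /xco /yco e e'.
rewrite /deg -(card_in_imset finj); apply: leq_trans (max_card _) _.
by rewrite card_prod card_bool.
Qed.

Lemma grid_deg_gt0 p q (v : vert (Q p q)) : 0 < p -> 0 < deg v.
Proof.
move=> p0; have [x0|x0] := ltnP v.1 p.
  have [|d [sd _]] := @gdart_ex p q v (false, true) => //.
  by apply/card_gt0P; exists d; rewrite inE; apply/eqP.
have [|d [sd _]] := @gdart_ex p q v (false, false); first by rewrite /leaves_at; lia.
by apply/card_gt0P; exists d; rewrite inE; apply/eqP.
Qed.

(** * Signed area *)

Local Open Scope ring_scope.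

(** By simple connectivity the sum of [w] along a walk depends only on its end points, as neither
    of the two elementary homotopies changes it. *)
Lemma exact_cochain (D : cplx) (w : dart D -> int) : disk_diagram D ->
  (forall d, w (flip d) = - w d) ->
  (forall d f, side d = Some f -> \sum_(e <- orbit nxt d) w e = 0) ->
  exists h : vert D -> int, forall d, h (tgt d) = h (src d) + w d.
Proof.
move=> dd wF wC; have fK := dd_flipK dd.
have cF : closed_sub (full D) by split=> *; rewrite inE.
pose I (s : seq (dart D)) := \sum_(e <- s) w e.
have inv x y s t : homotopic (full D) x y s t -> I s = I t.
  rewrite /I; elim=> {s t} //.
  - by move=> s t u _ -> _ ->.
  - by move=> s t d _ _; rewrite !big_cat /= !big_cons big_nil wF; ring.
  - by move=> s t d f sd _ _ _; rewrite !big_cat /= (wC _ _ sd) add0r.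
have [[b _] con] := dd_connected dd.
have exP v : exists s, walk (full D) b s v by apply: con; rewrite inE.
exists (fun v => I (xchoose (exP v))) => d.
set s := xchoose _; set t := xchoose _.
have ws : walk (full D) b s (tgt d) by exact: (xchooseP (exP (tgt d))).
have wt : walk (full D) b t (src d) by exact: (xchooseP (exP (src d))).
have wd : walk (full D) (src d) [:: d] (tgt d) by apply: (walk1 cF); rewrite inE.
have wtd : walk (full D) b (t ++ [:: d]) (tgt d) by apply/walk_cat => //; exists (src d).
have wr := walk_rev fK cF ws.
have h1 := homotopic_rev_walkl fK cF ws.
have wc : walk (full D) (tgt d) (rev_walk s ++ t ++ [:: d]) (tgt d).
  by apply/walk_cat => //; exists b.
have h2 := dd_simply_connected dd (in_setT (tgt d)) wc.
have := inv _ _ _ _ (Htp_trans h1 (Htp_sym h2)).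
by rewrite /I !big_cat /= big_seq1 => /addrI.
Qed.

Definition aexp (l : letter bool) : int := if l.1 then 0 else if l.2 then 1 else -1.
Definition bexp (l : letter bool) : int := if l.1 then if l.2 then 1 else -1 else 0.

(** The integral of x dy along the lattice path that reads [w] from abscissa [x]. *)
Fixpoint xdy (x : int) (w : seq (letter bool)) : int :=
  if w is l :: w' then x * bexp l + xdy (x + aexp l) w' else 0.

Lemma xdy_cat x u v :
  xdy x (u ++ v) = xdy x u + xdy (x + \sum_(l <- u) aexp l) v.
Proof.
elim: u x => [|l u IH] x /=; first by rewrite big_nil add0r addr0.
by rewrite IH big_cons !addrA.
Qed.

Lemma aexp_nseq n l : \sum_(l' <- nseq n l) aexp l' = n%:Z * aexp l.
Proof. by rewrite big_nseq iter_addr_0 -mulr_natl natz. Qed.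

Lemma xdy_nseq x n (s : bool) :
  xdy x (nseq n (true, s)) = n%:Z * x * bexp (true, s) /\
  xdy x (nseq n (false, s)) = 0.
Proof.
elim: n x => [|n IH] x; first by rewrite /= !mul0r.
have [IH1 _] := IH (x + 0); have [_ IH2] := IH (x + aexp (false, s)).
by rewrite /= IH1 IH2 /aexp /bexp /=; split; [rewrite -addn1 PoszD; ring|ring].
Qed.

Lemma xdy_grid p q : xdy 0 (grid_word p q) = (p * q)%N%:Z.
Proof.
rewrite /grid_word !xdy_cat !aexp_nseq.
rewrite /la /lb /lA /lB.
rewrite !(xdy_nseq _ _ _).1 !(xdy_nseq _ _ _).2 /aexp /bexp /= PoszM; ring.
Qed.

(** Along a closed path the integral is the enclosed signed area, here that of one unit square. *)
Lemma xdy_relator x n w : (n <= 4)%N ->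
  w = rot n [:: la; lb; lA; lB] \/ w = rot n (winv [:: la; lb; lA; lB]) ->
  \sum_(l <- w) aexp l = 0 /\ `|xdy x w| = 1.
Proof.
move=> n4 ww; suff: \sum_(l <- w) aexp l = 0 /\ (xdy x w = 1 \/ xdy x w = -1).
  by case=> -> [] ->.
case: ww => ->; case: n n4 => [|[|[|[|[|n]]]]] // _; rewrite /rot /winv /rev /=;
  rewrite !big_cons big_nil /aexp /bexp /=; (split; first by []);
  by [left; ring|right; ring].
Qed.

Lemma sum_border (D : cplx) (d : dart D) (w : dart D -> int) : disk_diagram D ->
  \sum_(e | side e == side d) w e = \sum_(e <- orbit nxt d) w e.
Proof.
move=> dd; rewrite [RHS]big_uniq ?orbit_uniq //=.
by apply: eq_bigl => e; rewrite -fconnect_orbit -(dd_side dd) eq_sym.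
Qed.

Lemma cycle_xdy (D : cplx) (lab : dart D -> letter bool) (h : vert D -> int) d :
  disk_diagram D -> (forall d, h (tgt d) = h (src d) + aexp (lab d)) ->
  \sum_(e <- orbit nxt d) h (src e) * bexp (lab e) = xdy (h (src d)) (map lab (orbit nxt d)).
Proof.
move=> dd hh; rewrite /orbit; elim: (order nxt d) {1 3 4}d => [|n IH] {}d /=.
  by rewrite big_nil.
by rewrite big_cons IH -hh (dd_nxt_src dd).
Qed.

(** The form x dy sums to zero over all darts since reversal negates it on vertical edges and it
    vanishes on horizontal ones.  Grouped by regions, the outer one contributes [p * q] and each
    cell 1 or -1. *)
Lemma area_ge (p q : nat) (D : cplx) (lab : dart D -> letter bool) : (0 < p)%N ->
  van_kampen commutator_rels lab (grid_word p q) -> (p * q <= #|cell D|)%N.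
Proof.
move=> p0 [dd labF labC labB]; have fK := dd_flipK dd.
have relP d f : side d = Some f -> forall x,
    \sum_(l <- map lab (orbit nxt d)) aexp l = 0 /\ `|xdy x (map lab (orbit nxt d))| = 1.
  move=> sd x; have [r [n []]] := labC _ _ sd; rewrite inE => /eqP-> n4 ww.
  exact: xdy_relator n4 ww.
have [||h hh] := @exact_cochain D (aexp \o lab) dd.
- by move=> d /=; rewrite labF /aexp /linv /=; case: (lab d) => [[] []] /=; rewrite ?oppr0 ?opprK.
- by move=> d f sd /=; have [+ _] := relP _ _ sd 0; rewrite big_map.
case: labB => [[d0 sd0 eqw]|[_]]; last by case: p p0.
(* The outer walk may start at any abscissa, because the boundary word has b-exponent 0. *)
have shift (x y : int) u : xdy x u = xdy y u + (x - y) * \sum_(l <- u) bexp l.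
  elim: u x y => [|l u IH] x y /=; first by rewrite big_nil mulr0 addr0.
  by rewrite big_cons (IH _ (y + aexp l)); ring.
have outer : \sum_(e | side e == None) h (src e) * bexp (lab e) = (p * q)%N%:Z.
  rewrite -sd0 (@sum_border D d0 (fun e => h (src e) * bexp (lab e)) dd).
  rewrite (cycle_xdy _ dd hh) -eqw (shift _ 0) xdy_grid.
  have -> : \sum_(l <- grid_word p q) bexp l = 0; last by rewrite mulr0 addr0.
  by rewrite /grid_word !big_cat /= !big_nseq !iter_addr_0 /bexp /= !mul0rn mulNrn; lia.
have tot : \sum_e h (src e) * bexp (lab e) = 0.
  set T := \sum_e _; suff: T = - T by lia.
  rewrite {1}/T (reindex_inj (inv_inj fK)) /= -sumrN; apply: eq_bigr => e _.
  by rewrite -/(tgt e) hh labF /= /aexp /bexp /linv; case: (lab e) => [[] []] /=; ring.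
have part : \sum_e h (src e) * bexp (lab e) =
    \sum_(o : option (cell D)) \sum_(e | side e == o) h (src e) * bexp (lab e).
  by rewrite (partition_big (@side D) xpredT).
have cellP f : `|\sum_(e | side e == Some f) h (src e) * bexp (lab e)| <= 1.
  have [//|d sd] := @dd_side_onto _ dd _ (Some f); first by apply/card_gt0P; exists d0.
  rewrite -sd (@sum_border D d (fun e => h (src e) * bexp (lab e)) dd).
  by rewrite (cycle_xdy _ dd hh); have [_ ->] := relP _ _ sd (h (src d)).
have : (p * q)%N%:Z = - \sum_(o | o != None) \sum_(e | side e == o) h (src e) * bexp (lab e).
  by move: part; rewrite tot (bigD1 None) //= outer => /esym/eqP; rewrite addr_eq0 => /eqP.
move=> eqpq; have : `|(p * q)%N%:Z| <= \sum_(o : option (cell D) | o != None) 1.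
  rewrite eqpq normrN; apply: le_trans (ler_norm_sum _ _ _) _.
  by apply: ler_sum => -[f _|//]; apply: cellP.
by rewrite sumr_const cardC1 card_option /=; lia.
Qed.

Lemma grid_area_minimising p q : (0 < p)%N -> (0 < q)%N ->
  area_minimising commutator_rels (@Qlab p q) (grid_word p q).
Proof.
move=> p0 q0; split; first exact: grid_van_kampen.
by move=> D' lab' vk; rewrite card_prod !card_ord; apply: area_ge p0 vk.
Qed.

(** * Dirichlet sums on the grid *)

Lemma sum_sig (R : nmodType) (T : finType) (P : pred T) (F : T -> R) :
  \sum_(u : {x | P x}) F (val u) = \sum_(x | P x) F x.
Proof.
rewrite [RHS](@reindex_omap _ _ _ _ {x | P x} val insub) => [|x Px]; last by rewrite insubT.
by apply: eq_bigl => u; rewrite valP valK eqxx.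
Qed.

(** Reading a function at natural coordinates, so that increments along unit steps need no
    bounds. *)
Definition at_xy (R : Type) p q (F : gvert p q -> R) (x y : nat) : R := F (inord x, inord y).

Lemma at_xyE (R : Type) p q (F : gvert p q -> R) (v : gvert p q) : at_xy F v.1 v.2 = F v.
Proof. by rewrite /at_xy !inord_val; case: v. Qed.

Lemma dirichlet_sum (R : realFieldType) p q (F : gvert p q -> R) :
  \sum_(d : gdart p q) (F (gtgt d) - F (gsrc d)) ^+ 2 =
  \sum_(vl : gvert p q * (bool * bool) | leaves vl)
    (at_xy F (xstep vl.1.1 vl.2) (ystep vl.1.2 vl.2) - at_xy F vl.1.1 vl.1.2) ^+ 2.
Proof.
rewrite -(@sum_sig _ _ (fun vl => leaves vl)); apply: eq_bigr => d _.
by have [e1 e2] := gtgtE d; rewrite -(at_xyE F (gtgt d)) -(at_xyE F (gsrc d)) e1 e2.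
Qed.

Lemma sqr_sum_le (R : realFieldType) (a : nat -> R) n :
  (\sum_(i < n) a i) ^+ 2 <= n%:R * \sum_(i < n) a i ^+ 2.
Proof.
elim: n => [|n IH]; first by rewrite !big_ord0 expr0n mul0r.
rewrite !big_ord_recr /=; case: n IH => [|n] IH.
  by rewrite !big_ord0 !add0r mul1r.
set S := \sum_(i < _) a i in IH *; set T := \sum_(i < _) a i ^+ 2 in IH *.
set b := a n.+1; have n0 : 0 < n.+1%:R :> R by rewrite ltr0n.
rewrite -[n.+2]addn1 natrD -(ler_pM2l n0).
have := sqr_ge0 (S - n.+1%:R * b); set N := n.+1%:R in IH n0 *; nra.
Qed.

(** Telescope from 0 to [x], then use Cauchy-Schwarz ([sqr_sum_le]). *)
Lemma poincare1 (R : realFieldType) (g : nat -> R) n : g 0%N = 0 ->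
  \sum_(x < n.+1) g x ^+ 2 <= n.+1%:R * n%:R * \sum_(x < n) (g x.+1 - g x) ^+ 2.
Proof.
move=> g0; set T := \sum_(x < n) _.
have gx x : (x <= n)%N -> g x ^+ 2 <= n%:R * T.
  move=> xn; have -> : g x = \sum_(i < x) (g i.+1 - g i).
    by rewrite -(big_mkord xpredT (fun i => g i.+1 - g i)) telescope_sumr // g0 subr0.
  apply: le_trans (sqr_sum_le (fun i => g i.+1 - g i) x) _.
  apply: ler_pM; rewrite ?ler0n ?ler_nat //; first by apply: sumr_ge0 => i _; apply: sqr_ge0.
  rewrite /T -(big_mkord xpredT (fun i => (g i.+1 - g i) ^+ 2)).
  rewrite -[X in _ <= X](big_mkord xpredT (fun i => (g i.+1 - g i) ^+ 2)).
  rewrite [X in _ <= X](@big_cat_nat _ _ _ x) //= lerDl.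
  by apply: sumr_ge0 => i _; apply: sqr_ge0.
apply: (@le_trans _ _ (\sum_(x < n.+1) n%:R * T)).
  by apply: ler_sum => x _; apply: gx; rewrite -ltnS.
by rewrite sumr_const card_ord -[X in X <= _]mulr_natl mulrA.
Qed.

(** Apply [poincare1] to each row; the darts that do not point east only add nonnegative
    terms. *)
Lemma poincare_grid (R : realFieldType) p q (F : gvert p q -> R) :
  (forall v : gvert p q, v.1 = 0 :> nat -> F v = 0) ->
  \sum_v F v ^+ 2 <=
    p.+1%:R * p%:R * \sum_(d : gdart p q) (F (gtgt d) - F (gsrc d)) ^+ 2.
Proof.
move=> F0; rewrite dirichlet_sum.
apply: (@le_trans _ _ (p.+1%:R * p%:R * \sum_(y < q.+1) \sum_(x < p)
    (at_xy F x.+1 y - at_xy F x y) ^+ 2)).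
  rewrite (eq_bigr (fun v : gvert p q => at_xy F v.1 v.2 ^+ 2)); last by move=> v _;
    rewrite at_xyE.
  rewrite -(pair_big xpredT xpredT (fun (x : 'I_p.+1) (y : 'I_q.+1) => at_xy F x y ^+ 2)) /=.
  rewrite exchange_big /= mulr_sumr; apply: ler_sum => y _.
  apply: (@poincare1 _ (fun x => at_xy F x y)).
  by rewrite /at_xy F0 //= inordK.
apply: ler_wpM2l; first by rewrite mulr_ge0 ?ler0n.
pose G (vl : gvert p q * (bool * bool)) :=
  (at_xy F (xstep vl.1.1 vl.2) (ystep vl.1.2 vl.2) - at_xy F vl.1.1 vl.1.2) ^+ 2.
rewrite (bigID (fun vl => vl.2 == (false, true))) /= -[X in X <= _]addr0.
apply: lerD; last by apply: sumr_ge0 => vl _; apply: sqr_ge0.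
pose h (u : 'I_q.+1 * 'I_p) : gvert p q * (bool * bool) :=
  ((widen_ord (leqnSn p) u.2, u.1), (false, true)).
pose h' (vl : gvert p q * (bool * bool)) : option ('I_q.+1 * 'I_p) :=
  omap (pair vl.1.2) (insub (vl.1.1 : nat)).
rewrite (reindex_omap h h').
  rewrite (pair_big xpredT xpredT (fun (y : 'I_q.+1) (x : 'I_p) =>
    (at_xy F x.+1 y - at_xy F x y) ^+ 2)) /=.
  rewrite le_eqVlt; apply/orP; left; apply/eqP; apply: eq_big => -[y x] /=.
    by rewrite /h' /= valK (valP x : (x < p)%N) !eqxx.
  by [].
move=> [[x y] l] /= /andP[xp /eqP el]; rewrite el in xp *.
by rewrite /h' /= insubT /= /h /=; congr (Some (_, _, _)); apply/val_inj.
Qed.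

Definition tent (n x : nat) : nat := minn x (n - x).

(** The rising half alone suffices: the squares up to m sum to at least m ^ 3 / 3, and n is at
    most 3 (n / 2). *)
Lemma tent_sum n : (2 <= n)%N -> (n ^ 3 <= 81 * \sum_(x < n.+1) tent n x ^ 2)%N.
Proof.
move=> n2; have sq k : (k ^ 3 <= 3 * \sum_(x < k.+1) x ^ 2)%N.
  have s6 : (6 * \sum_(x < k.+1) x ^ 2 = k * k.+1 * (2 * k + 1))%N.
    elim: k => [|k IH]; first by rewrite big_ord_recl big_ord0.
    by rewrite big_ord_recr /= mulnDr IH -mulnn; lia.
  by rewrite !expnS expn0 muln1; nia.
have m : (n <= 3 * n./2)%N by lia.
have : (\sum_(x < n./2.+1) x ^ 2 <= \sum_(x < n.+1) tent n x ^ 2)%N.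
  rewrite -(big_mkord xpredT (fun x => x ^ 2)%N) -(big_mkord xpredT (fun x => tent n x ^ 2)%N).
  rewrite [leqRHS](@big_cat_nat _ _ _ n./2.+1) //=; last by lia.
  apply: leq_trans (leq_addr _ _); rewrite big_nat_cond [leqRHS]big_nat_cond.
  apply: leq_sum => x /andP[/andP[_ hx] _]; rewrite /tent leq_sqr; lia.
have := sq n./2; move: (\sum_(x < _) _)%N (\sum_(x < _) _)%N => a b h1 h2.
have : (n ^ 3 <= (3 * n./2) ^ 3)%N by rewrite leq_exp2r.
rewrite expnMn; lia.
Qed.

Lemma tent_step n x : (x < n)%N ->
  (tent n x.+1 <= (tent n x).+1)%N /\ (tent n x <= (tent n x.+1).+1)%N.
Proof. by rewrite /tent; lia. Qed.

Lemma sqr_diff_le1 (R : realFieldType) (a b : nat) : (a <= b.+1)%N -> (b <= a.+1)%N ->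
  (a%:R - b%:R : R) ^+ 2 <= 1.
Proof.
move=> h1 h2; have [e|[e|e]] : (a = b \/ a = b.+1 \/ b = a.+1)%N by lia.
- by rewrite e subrr expr0n ler01.
- by rewrite e -addn1 natrD addrAC subrr add0r expr1n.
by rewrite e -addn1 natrD opprD addrA subrr add0r sqrrN expr1n.
Qed.

Definition tent2 (R : realFieldType) p q (v : gvert p q) : R := (tent p v.1 * tent q v.2)%N%:R.

(** An increment along one factor is at most 1, times the value of the other factor. *)
Lemma tent2_dirichlet (R : realFieldType) p q :
  \sum_(d : gdart p q) (tent2 R (gtgt d) - tent2 R (gsrc d)) ^+ 2 <=
  2 * (p.+1%:R * (\sum_(y < q.+1) tent q y ^ 2)%N%:R + q.+1%:R * (\sum_(x < p.+1) tent p x ^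
    2)%N%:R).
Proof.
pose H (vl : gvert p q * (bool * bool)) : R :=
  if vl.2.1 then (tent p vl.1.1 ^ 2)%N%:R else (tent q vl.1.2 ^ 2)%N%:R.
have cE x y : (x <= p)%N -> (y <= q)%N -> at_xy (@tent2 R p q) x y = (tent p x * tent q y)%N%:R.
  by move=> hx hy; rewrite /at_xy /tent2 /= !inordK.
rewrite dirichlet_sum; apply: (@le_trans _ _ (\sum_vl H vl)).
  rewrite big_mkcond /=; apply: ler_sum => -[[x y] l] _; rewrite /H /=.
  have hx : (x <= p)%N by rewrite -ltnS.
  have hy : (y <= q)%N by rewrite -ltnS.
  have sq (a b c : nat) : (a <= b.+1)%N -> (b <= a.+1)%N ->
      ((c * a)%N%:R - (c * b)%N%:R : R) ^+ 2 <= (c ^ 2)%N%:R.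
    move=> h1 h2; rewrite natrX !natrM -mulrBr exprMn ler_piMr ?sqr_ge0 //.
    exact: sqr_diff_le1.
  case: ifP => [hl|_]; last by case: ifP => _; rewrite ler0n.
  case: l hl => [[] []] /= hl; rewrite /xstep /ystep /=; rewrite !cE //; try lia.
  - by have [? ?] := tent_step hl; apply: sq.
  - have := @tent_step q y.-1; rewrite (prednK hl) => -[|? ?]; first by lia.
    exact: sq.
  - by have [? ?] := tent_step hl; rewrite ![(_ * tent q y)%N]mulnC; apply: sq.
  have := @tent_step p x.-1; rewrite (prednK hl) => -[|? ?]; first by lia.
  by rewrite ![(_ * tent q y)%N]mulnC; apply: sq.
have sum4 (f : bool * bool -> R) : \sum_l f l =
    f (true, true) + f (true, false) + (f (false, true) + f (false, false)).
  rewrite (eq_bigr (fun l => f (l.1, l.2))); last by case.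
  by rewrite -(pair_big xpredT xpredT (fun a b => f (a, b))) /= !big_bool.
rewrite (eq_bigr (fun vl => H (vl.1, vl.2))); last by case.
rewrite -(pair_big xpredT xpredT (fun (v : gvert p q) (l : bool * bool) => H (v, l))) /=.
rewrite (eq_bigr (fun v : gvert p q => 2 * (tent p v.1 ^ 2)%N%:R + 2 * (tent q v.2 ^ 2)%N%:R));
  last first.
  by move=> v _; rewrite sum4 /H /=; ring.
rewrite -(pair_big xpredT xpredT (fun (x : 'I_p.+1) (y : 'I_q.+1) =>
   2 * (tent p x ^ 2)%N%:R + 2 * (tent q y ^ 2)%N%:R)) /=.
under eq_bigr => x _ do rewrite big_split sumr_const card_ord /= -mulr_sumr.
rewrite big_split /= sumrMnl -mulr_sumr sumr_const card_ord !natr_sum.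
by rewrite -[X in X + _]mulr_natl -[X in _ + X <= _]mulr_natl le_eqVlt; apply/orP; left;
  apply/eqP; ring.
Qed.

(** * The spectral gap and the filling length *)

From mathcomp Require Import all_classical all_reals all_analysis.

Lemma ext0_val (R : realType) (D : cplx) (f : inner D -> R) (u : inner D) : ext0 f (val u) = f u.
Proof. by rewrite /ext0 valK. Qed.

Lemma ext0_bverts (R : realType) (D : cplx) (f : inner D -> R) v :
  v \in bverts (full D) -> ext0 f v = 0.
Proof. by move=> hv; rewrite /ext0 insubN // negbK. Qed.

Lemma rayleigh_den_gt0 (R : realType) p q (f : inner (Q p q) -> R) : (0 < p)%N ->
  (exists v, f v != 0) -> 0 < \sum_(v : inner (Q p q)) (deg (val v))%:R * f v ^+ 2.
Proof.
move=> p0 [v fv]; rewrite (bigD1 v) //=; apply: ltr_pwDl.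
  by rewrite mulr_gt0 ?ltr0n ?(@grid_deg_gt0 p q) // lt0r sqrf_eq0 fv sqr_ge0.
by apply: sumr_ge0 => u _; rewrite mulr_ge0 ?ler0n ?sqr_ge0.
Qed.

Lemma sum_ext0 (R : realType) (D : cplx) (f : inner D -> R) :
  \sum_v ext0 f v ^+ 2 = \sum_(u : inner D) f u ^+ 2.
Proof.
rewrite (bigID (fun v => v \in bverts (full D))) /= big1 ?add0r; last first.
  by move=> v hv; rewrite ext0_bverts // expr0n.
rewrite -(@sum_sig _ _ (fun v => v \notin bverts (full D)) (fun v => ext0 f v ^+ 2)).
by apply: eq_bigr => u _; rewrite ext0_val.
Qed.

Lemma grid_energy (R : realType) p q (F : gvert p q -> R) :
  \sum_(d : dart (Q p q)) (F (tgt d) - F (src d)) ^+ 2 =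
  \sum_(d : gdart p q) (F (gtgt d) - F (gsrc d)) ^+ 2.
Proof.
apply: eq_bigr => d _; have -> : tgt d = gtgt d; last by [].
by rewrite -[tgt d]/(val (gflip d)).1 gflip_val.
Qed.

Lemma rayleigh_ge (R : realType) p q (f : inner (Q p q) -> R) : (0 < p)%N -> (0 < q)%N ->
  (exists v, f v != 0) -> (16 * p%:R ^+ 2)^-1 <= rayleigh f.
Proof.
move=> p0 q0 f0; have den0 := rayleigh_den_gt0 p0 f0.
rewrite /rayleigh (grid_energy (ext0 f)).
set den := \sum_(v : inner _) _ in den0 *.
set E := \sum_(d : gdart p q) _.
have hp : \sum_v ext0 f v ^+ 2 <= p.+1%:R * p%:R * E.
  apply: (poincare_grid (F := ext0 f)) => v v0.
  by apply: ext0_bverts; rewrite grid_bverts // v0 eqxx.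
have hden : den <= 4 * \sum_v ext0 f v ^+ 2.
  rewrite sum_ext0 mulr_sumr; apply: ler_sum => u _.
  by apply: ler_wpM2r; rewrite ?sqr_ge0 // (ler_nat R _ 4) grid_deg_le4.
have E0 : 0 <= E by apply: sumr_ge0 => d _; apply: sqr_ge0.
have P1 : 1 <= p%:R :> R by rewrite ler1n.
have P0 : 0 < 16 * p%:R ^+ 2 :> R by nra.
rewrite ler_pdivlMr // -(ler_pM2l P0) mulrA divff ?gt_eqF // mul1r.
apply: le_trans hden _; rewrite -natr1 in hp.
have : (p%:R + 1) * p%:R * E <= 2 * p%:R ^+ 2 * E by apply: ler_wpM2r => //; nra.
by move: (\sum_v _) hp => X hp h2; rewrite (_ : _ * (_ * E) = 4 * (2 * p%:R ^+ 2 * E));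
  [lra|field].
Qed.

Lemma tent2_gt0 (R : realType) p q : (2 <= p)%N -> (2 <= q)%N ->
  exists v : inner (Q p q), (tent2 R (val v)) != 0.
Proof.
move=> p2 q2; have hp : (1 < p.+1)%N by lia.
have hq : (1 < q.+1)%N by lia.
have hv : (Ordinal hp, Ordinal hq) \notin bverts (full (Q p q)).
  rewrite grid_bverts /=; lia.
exists (exist (fun w => w \notin bverts (full (Q p q))) _ hv);
  rewrite /tent2 /tent /= pnatr_eq0; lia.
Qed.

Lemma lambda1_ge (R : realType) p q : (2 <= p)%N -> (2 <= q)%N ->
  (16 * p%:R ^+ 2)^-1 <= lambda1 R (Q p q).
Proof.
move=> p2 q2; have p0 : (0 < p)%N by lia.
have q0 : (0 < q)%N by lia.
apply: lb_le_inf => [|_ [f [f0 ->]]]; last exact: rayleigh_ge.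
have [v v0] := tent2_gt0 R p2 q2; exists (rayleigh (fun u : inner (Q p q) => tent2 R (val u))).
by exists (fun u : inner (Q p q) => tent2 R (val u)); split=> //; exists v.
Qed.

Lemma ext0_tent2 (R : realType) p q (v : gvert p q) : (0 < p)%N -> (0 < q)%N ->
  ext0 (fun u : inner (Q p q) => tent2 R (val u)) v = tent2 R v.
Proof.
move=> p0 q0; have [hv|hv] := boolP (v \in bverts (full (Q p q))).
  rewrite ext0_bverts //; move: hv; rewrite grid_bverts // /tent2 /tent.
  case/or4P => /eqP ->; by rewrite ?subnn ?minn0 ?min0n ?mul0n ?muln0.
by rewrite -[v in LHS]/(val (exist (fun w => w \notin bverts (full (Q p q))) v hv)) ext0_val.
Qed.

(** For the product of two tents with sums of squares A and B, the quotient is at most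
    (p + 1) / A + (q + 1) / B; degrees enter only through being positive. *)
Lemma lambda1_le (R : realType) p q : (2 <= p)%N -> (2 <= q)%N ->
  lambda1 R (Q p q) <= 162 * (p%:R ^- 2 + q%:R ^- 2).
Proof.
move=> p2 q2; have p0 : (0 < p)%N by lia.
have q0 : (0 < q)%N by lia.
pose f (u : inner (Q p q)) : R := tent2 R (val u).
have f0 : exists v, f v != 0 by apply: tent2_gt0.
have den0 := rayleigh_den_gt0 p0 f0.
apply: (@le_trans _ _ (rayleigh f)).
  apply: ge_inf; last by exists f.
  by exists 0 => _ [g [g0 ->]]; apply: le_trans (rayleigh_ge p0 q0 g0);
    rewrite invr_ge0 mulr_ge0 ?sqr_ge0.
rewrite /rayleigh (grid_energy (ext0 f)).
have eF : ext0 f =1 @tent2 R p q by move=> v; apply: ext0_tent2.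
rewrite (eq_bigr (fun d : gdart p q => (tent2 R (gtgt d) - tent2 R (gsrc d)) ^+ 2)); last first.
  by move=> d _; rewrite !eF.
have hE := tent2_dirichlet R p q.
set den := \sum_(v : inner _) _ in den0 *; set E := \sum_(d : gdart p q) _ in hE *.
set A := (\sum_(x < p.+1) tent p x ^ 2)%N in hE.
set B := (\sum_(y < q.+1) tent q y ^ 2)%N in hE.
have hden : (A * B)%N%:R <= den.
  have -> : (A * B)%N%:R = \sum_v ext0 f v ^+ 2.
    rewrite (eq_bigr (fun v : gvert p q => ((tent p v.1 ^ 2) * (tent q v.2 ^ 2))%N%:R));
      last first.
      by move=> v _; rewrite eF /tent2 -expnMn natrX.
    rewrite -natr_sum; congr (_%:R); rewrite /A /B big_distrl /=.
    under eq_bigr => x _ do rewrite big_distrr /=.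
    by rewrite pair_big.
  rewrite sum_ext0; apply: ler_sum => u _.
  by rewrite ler_peMl ?sqr_ge0 // ler1n (@grid_deg_gt0 p q).
have hA := tent_sum p2; have hB := tent_sum q2; rewrite -/A in hA; rewrite -/B in hB.
have A0 : (0 < A)%N by rewrite lt0n; apply/eqP => e; rewrite e in hA; nia.
have B0 : (0 < B)%N by rewrite lt0n; apply/eqP => e; rewrite e in hB; nia.
have half (n C : nat) : (2 <= n)%N -> (0 < C)%N -> (n ^ 3 <= 81 * C)%N ->
    n.+1%:R / C%:R <= 162 * n%:R ^- 2 :> R.
  move=> n2 C0 h; have n0 : (0 < n)%N by lia.
  have C0' : 0 < C%:R :> R by rewrite ltr0n.
  have n0' : 0 < n%:R ^+ 2 :> R by rewrite exprn_gt0 ?ltr0n.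
  rewrite ler_pdivrMr // -(ler_pM2r n0') mulrAC divfK ?gt_eqF //.
  by rewrite -natrX -!natrM ler_nat; move: h; rewrite !expnS expn0; nia.
have AB0 : 0 < (A * B)%N%:R :> R by rewrite ltr0n muln_gt0 A0.
apply: (@le_trans _ _ (2^-1 * E / (A * B)%N%:R)).
  rewrite ler_wpM2l ?lef_pV2 ?posrE //.
  by rewrite mulr_ge0 ?invr_ge0 //; apply: sumr_ge0 => d _; apply: sqr_ge0.
apply: (@le_trans _ _ (p.+1%:R / A%:R + q.+1%:R / B%:R)); last first.
  by rewrite mulrDr; apply: lerD; apply: half.
rewrite ler_pdivrMr // natrM.
have A1 : A%:R != 0 :> R by rewrite pnatr_eq0 -lt0n.
have B1 : B%:R != 0 :> R by rewrite pnatr_eq0 -lt0n.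
have -> : (p.+1%:R / A%:R + q.+1%:R / B%:R) * (A%:R * B%:R) =
  p.+1%:R * B%:R + q.+1%:R * A%:R :> R.
  by field; rewrite A1 B1.
by move: (_ + _) hE => X; lra.
Qed.

Lemma FL_ge (R : realType) p q (v : vert (Q p q)) : (0 < p)%N -> (0 < q)%N ->
  (p%:R%:E <= FL R v)%E.
Proof.
move=> p0 q0; apply: le_ereal_inf_tmp => _ [N [S [hS ->]]].
rewrite lee_fin ler_nat; apply: leq_trans (grid_perimeter p0 q0) _.
by rewrite -(bs_start hS) (bigD1 ord0) //= leq_maxl.
Qed.

Lemma FL_le (R : realType) p q (v : vert (Q p q)) : (0 < p)%N -> (0 < q)%N -> corner v ->
  (FL R v <= (4 * (p.+1 + q.+1))%N%:R%:E)%E.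
Proof.
move=> p0 q0 cv; have [N [S [hS bS]]] := corner_shelling p0 q0 cv.
apply: ge_ereal_inf; exists (\max_(j < N.+1) blength (S j))%:R%:E; first by exists N, S.
by rewrite lee_fin ler_nat; apply/bigmax_leqP => j _.
Qed.

Lemma powR_Nhalf (R : realType) (x : R) : 0 < x ->
  0 < x `^ (- 2^-1) /\ x * (x `^ (- 2^-1)) ^+ 2 = 1.
Proof.
move=> x0; split; first exact: powR_gt0.
by rewrite powRN powR12_sqrt ?ltW // exprVn sqr_sqrtr ?ltW // divff ?gt_eqF.
Qed.

(** By the bounds on lambda1, its inverse square root is at most 4 p and at least
    p / (13 (1 + K)). *)
Lemma FL_lambda1 (R : realType) (K : R) p q (v : vert (Q p q)) : 1 <= K ->
  (2 <= p)%N -> (2 <= q)%N -> K^-1 <= p%:R / q%:R <= K -> corner v ->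
  ((4^-1 * lambda1 R (Q p q) `^ (- 2^-1))%:E <= FL R v)%E /\
  (FL R v <= (144 * (1 + K) ^+ 2 * lambda1 R (Q p q) `^ (- 2^-1))%:E)%E.
Proof.
move=> K1 p2 q2 /andP[hK1 hK2] cv; have p0 : (0 < p)%N by lia.
have q0 : (0 < q)%N by lia.
have l1 := lambda1_ge R p2 q2; have l2 := lambda1_le R p2 q2.
have P2 : 2 <= p%:R :> R by rewrite (ler_nat R 2).
have Q2 : 2 <= q%:R :> R by rewrite (ler_nat R 2).
have K0 : 0 < K by lra.
have hqp : q%:R <= K * p%:R.
  have : K^-1 * q%:R <= p%:R by rewrite -ler_pdivlMr //; lra.
  by rewrite mulrC ler_pdivrMr // mulrC.
have hpq : p%:R <= K * q%:R by rewrite -ler_pdivrMr //; lra.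
have L0 : 0 < lambda1 R (Q p q).
  by apply: lt_le_trans l1; rewrite invr_gt0 mulr_gt0 // exprn_gt0; lra.
have [s0 s2] := powR_Nhalf L0.
move: (lambda1 R (Q p q)) (_ `^ _) L0 s0 s2 l1 l2 => L s L0 s0 s2 l1 l2.
split.
  apply: le_trans _ (@FL_ge R p q v p0 q0); rewrite lee_fin.
  have h : 1 <= 16 * p%:R ^+ 2 * L.
    have X0 : 0 < 16 * p%:R ^+ 2 :> R by rewrite mulr_gt0 // exprn_gt0; lra.
    by move: l1; rewrite -(ler_pM2l X0) mulfV // gt_eqF.
  have : s ^+ 2 <= (4 * p%:R) ^+ 2.
    have : 1 * s ^+ 2 <= 16 * p%:R ^+ 2 * L * s ^+ 2 by apply: ler_wpM2r => //; apply: sqr_ge0.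
    by rewrite -mulrA s2 exprMn; lra.
  rewrite ler_pXn2r ?nnegrE //; lra.
apply: le_trans (FL_le R p0 q0 cv) _; rewrite lee_fin.
have h : p%:R ^+ 2 * L <= 162 * (1 + K ^+ 2).
  have hP : 0 < p%:R ^+ 2 :> R by rewrite exprn_gt0; lra.
  have hQ : 0 < q%:R ^+ 2 :> R by rewrite exprn_gt0; lra.
  apply: (@le_trans _ _ (p%:R ^+ 2 * (162 * (p%:R ^- 2 + q%:R ^- 2)))).
    by apply: ler_wpM2l => //; apply: ltW.
  have : p%:R ^+ 2 / q%:R ^+ 2 <= K ^+ 2.
    by rewrite ler_pdivrMr // -exprMn ler_pXn2r ?nnegrE //; nra.
  rewrite mulrCA mulrDr divff ?gt_eqF //; lra.
have hs : p%:R ^+ 2 <= 162 * (1 + K ^+ 2) * s ^+ 2.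
  by have := ler_wpM2r (sqr_ge0 s) h; rewrite -[X in X <= _]mulrA s2 mulr1.
have : p%:R <= 13 * (1 + K) * s.
  (* 13 ^ 2 is at least 162, and (1 + K) ^ 2 at least 1 + K ^ 2. *)
  have : p%:R ^+ 2 <= (13 * (1 + K) * s) ^+ 2.
    apply: le_trans hs _; rewrite exprMn; apply: ler_wpM2r; first exact: sqr_ge0.
    nra.
  rewrite ler_pXn2r ?nnegrE //.
  by apply/ltW/mulr_gt0 => //; lra.
move=> hps; rewrite natrM natrD -!natr1.
have : 4 * (p%:R + 1 + (q%:R + 1)) <= 8 * (1 + K) * p%:R by nra.
have : 8 * (1 + K) * p%:R <= 8 * (1 + K) * (13 * (1 + K) * s).
  by apply: ler_wpM2l => //; lra.
by have : 0 <= (1 + K) ^+ 2 * s by [rewrite mulr_ge0 ?sqr_ge0 ?ltW]; rewrite expr2; nra.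
Qed.

Local Close Scope ring_scope.

Theorem theorem3 (R : realType) :
  (forall K : R, (1 <= K)%R ->
    exists c C : R, [/\ (0 < c)%R, (0 < C)%R &
      forall (p q : nat), 2 <= p -> 2 <= q ->
        (K^-1 <= p%:R / q%:R <= K)%R ->
        forall v : vert (Q p q), corner v ->
          ((c * lambda1 R (Q p q) `^ (- 2^-1))%:E <= FL R v)%E /\
          (FL R v <= (C * lambda1 R (Q p q) `^ (- 2^-1))%:E)%E])
  /\
  (forall p q : nat, 2 <= p -> 2 <= q ->
    area_minimising commutator_rels (@Qlab p q) (grid_word p q)).
Proof.
split=> [K K1|p q p2 q2]; last by apply: grid_area_minimising; apply: ltnW.
exists 4^-1%R, (144 * (1 + K) ^+ 2)%R; split=> [||p q p2 q2 hK v cv].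
- by rewrite invr_gt0.
- by rewrite mulr_gt0 // exprn_gt0; lra.
exact: FL_lambda1.
Qed.
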